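(* Let $A\in H_\alpha$ (not necessarily normalized), let $\psi_A$ and $\lambda_A$ be its main eigenfunction and eigenvalue, and let $\bar A=A+\log\psi_A-\log(\psi_A\circ\sigma)-\log\lambda_A$. Then: (a) there exists a unique Borel probability measure $\mu_A$ on $\mathcal B$ with $\mathcal L_{\bar A}^*(\mu_A)=\mu_A$, and $\mu_A$ is $\sigma$-invariant; (b) the measure $\rho_A=\frac{1}{\psi_A}\mu_A$ satisfies $\mathcal L_A^*(\rho_A)=\lambda_A\rho_A$; (c) for every Hölder continuous function $w:\mathcal B\to\mathbb R$, in the topology of uniform convergence, as $n\to\infty$, $$\mathcal L_{\bar A}^n(w)\to\int_{\mathcal B}w\,d\mu_A\qquad\text{and}\qquad \frac{\mathcal L_A^n(w)}{(\lambda_A)^n}\to\psi_A\int_{\mathcal B}w\,d\rho_A .$$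
   Context: $(M,d_M)$ is a compact metric space, $\mathcal B=M^{\mathbb N}$ (with $\mathbb N=\{1,2,\dots\}$) has the metric $d(x,y)=\sum_{n\ge1}2^{-n}d_M(x_n,y_n)$, $\sigma:\mathcal B\to\mathcal B$ is the shift $\sigma(x_1,x_2,\dots)=(x_2,x_3,\dots)$, and $\mathcal C$ is the space of continuous functions $\mathcal B\to\mathbb R$. Fix $\alpha\in(0,1]$; $H_\alpha$ is the set of $\alpha$-Hölder continuous functions $\mathcal B\to\mathbb R$. Fix a Borel probability measure $\nu$ on $M$ whose support is all of $M$. For $a\in M$, $x\in\mathcal B$, $ax=(a,x_1,x_2,\dots)$. For a Hölder potential $A$, $\mathcal L_A(\varphi)(x)=\int_M e^{A(ax)}\varphi(ax)\,d\nu(a)$; $\mathcal L_A^n$ is its $n$-th iterate. The dual operator on Borel measures on $\mathcal B$ is defined by $\int\varphi\,d\mathcal L_A^*(\mu)=\int\mathcal L_A(\varphi)\,d\mu$ for all $\varphi\in\mathcal C$. Main eigenfunction and eigenvalue: for $A\in H_\alpha$ there are $\lambda_A>0$ and a strictly positive $\psi_A\in H_\alpha$, unique up to a multiplicative constant and normalized by $\max\psi_A=1$, with $\mathcal L_A\psi_A=\lambda_A\psi_A$. A potential $B$ is normalized if $\mathcal L_B(1)=1$; $\bar A$ is normalized. *)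

(* Defs.v *)
From HB Require Import structures.
From mathcomp Require Import all_boot all_order all_algebra.
From mathcomp Require Import all_classical all_reals all_analysis.
From mathcomp Require Import measurable_realfun.

Set Implicit Arguments.
Unset Strict Implicit.
Unset Printing Implicit Defensive.

Import Order.TTheory GRing.Theory Num.Theory.
Import numFieldNormedType.Exports.

Local Open Scope classical_set_scope.
Local Open Scope ring_scope.

(* Measurable types are pointed in the library, so nonemptiness is part of the
   structure; a space carrying a probability measure is nonempty anyway. *)
HB.mixin Record isCompactMetric (R : numDomainType) M & Metric R M := {
  compact_setT : compact [set: M]
}.

#[short(type="compactMetricType")]
HB.structure Definition CompactMetric (R : numDomainType) :=
  { M of Metric R M & Pointed M & isCompactMetric R M }.

Notation borel T := (g_sigma_algebraType (@open T)).

(* Indices start at 0: [x n] is the coordinate x_(n+1). *)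
Definition seqspace (R : realType) (M : compactMetricType R) : Type := nat -> M.

HB.instance Definition _ (R : realType) (M : compactMetricType R) :=
  Pointed.copy (seqspace M) (nat -> M).

Section seqspace_metric.
Context {R : realType} {M : compactMetricType R}.
Implicit Types x y z : seqspace M.

Definition seqdist_term x y : R^nat :=
  fun n => 2 ^- n.+1 * mdist (x n) (y n).

Definition seqdist x y : R := limn (series (seqdist_term x y)).

Let seqdist_term_ge0 x y n : 0 <= seqdist_term x y n.
Proof. by rewrite /seqdist_term mulr_ge0// ?invr_ge0 ?exprn_ge0 ?mdist_ge0. Qed.

Let mdist_bounded : exists D : R, forall a b : M, mdist a b <= D.
Proof.
pose a0 : M := point.
have cd : continuous (mdist a0 : M -> R).
  move=> a; apply/cvgrPdist_lt => e e0.
  have := @nbhsx_ballx R M a _ e0.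
  apply: filterS => b; rewrite ballEmdist/= => abe.
  apply: le_lt_trans abe; rewrite ler_norml lerNl opprB !lerBlDl.
  by rewrite metric_triangle/= (metric_sym a b) metric_triangle.
have : compact (mdist a0 @` [set: M] : set R).
  by apply: continuous_compact; [exact: continuous_subspaceT|exact: compact_setT].
move=> /compact_bounded[N [_ /(_ (N + 1))]]; rewrite ltrDl => /(_ ltr01) HN.
exists ((N + 1) + (N + 1)) => a b.
have ub c : mdist a0 c <= N + 1.
  by apply: le_trans (ler_norm _) _; apply: HN; exists c.
apply: le_trans (metric_triangle a a0 b) _.
by rewrite metric_sym lerD.
Qed.

Let is_cvg_seqdist x y : cvgn (series (seqdist_term x y)).
Proof.
have [D HD] := mdist_bounded.
apply: (@series_le_cvg _ _ (geometric D (2^-1))) => //.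
- move=> n; rewrite /geometric /=.
  by rewrite mulr_ge0 ?exprn_ge0// (le_trans _ (HD (x n) (x n)))// mdist_ge0.
- move=> n; rewrite /geometric /= /seqdist_term mulrC exprVn.
  apply: ler_pM => //; [exact: mdist_ge0|].
  by rewrite lef_pV2 ?posrE// exprS ler_peMl// ler1n.
- by apply: is_cvg_geometric_series; rewrite ger0_norm// invf_lt1// ltr1n.
Qed.

Let seqdistxx x : seqdist x x = 0.
Proof.
rewrite /seqdist (_ : series _ = fun=> 0) ?lim_cst//.
apply/funext => n; rewrite /series/= big1// => i _.
by rewrite /seqdist_term mdistxx mulr0.
Qed.

Let seqdist_positivity x y : seqdist x y = 0 -> x = y.
Proof.
move=> d0; apply/funext => n; apply: mdist_positivity.
have : series (seqdist_term x y) n.+1 <= 0.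
  rewrite -d0; apply: nondecreasing_cvgn_le; last exact: is_cvg_seqdist.
  by apply: nondecreasing_series => i _ _; exact: seqdist_term_ge0.
rewrite /series/= big_nat_recr//= => H.
have {}H : seqdist_term x y n <= 0.
  apply: le_trans H; rewrite lerDr.
  by apply: sumr_ge0 => i _; exact: seqdist_term_ge0.
have /eqP : seqdist_term x y n = 0.
  by apply/eqP; rewrite eq_le H seqdist_term_ge0.
by rewrite mulf_eq0 invr_eq0 expf_eq0/= pnatr_eq0/= => /eqP.
Qed.

Let seqdist_sym x y : seqdist x y = seqdist y x.
Proof.
by congr (limn (series _)); apply/funext => n; rewrite /seqdist_term metric_sym.
Qed.

Let seqdist_triangle y x z : seqdist x z <= seqdist x y + seqdist y z.
Proof.
rewrite /seqdist -lim_seriesD; [|exact: is_cvg_seqdist..].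
apply: lim_series_le; first exact: is_cvg_seqdist.
  by apply: is_cvg_seriesD; exact: is_cvg_seqdist.
move=> n; rewrite /seqdist_term /= -mulrDr.
apply: ler_wpM2l; first by rewrite invr_ge0 exprn_ge0.
exact: metric_triangle.
Qed.

HB.instance Definition _ := isMetric.Build R (seqspace M)
  seqdistxx seqdist_positivity seqdist_sym seqdist_triangle.

Lemma mdist_seqspaceE x y :
  mdist x y = limn (series (fun n => 2 ^- n.+1 * mdist (x n) (y n))).
Proof. by []. Qed.

End seqspace_metric.

Section transfer_operator.
Context {R : realType} {M : compactMetricType R}.
Local Notation B := (seqspace M).

Definition pcons (a : M) (x : B) : B :=
  fun n => if n is m.+1 then x m else a.

Definition shift (x : B) : B := fun n => x n.+1.

Definition holder (alpha : R) : set (B -> R) :=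
  [set f | exists C : R, forall x y : B,
    `|f x - f y| <= C * mdist x y `^ alpha].

Definition holder_continuous (f : B -> R) : Prop :=
  exists2 alpha, 0 < alpha <= 1 & holder alpha f.

Definition transfer (nu : probability (borel M) R) (A phi : B -> R) : B -> R :=
  fun x => \int[nu]_a (expR (A (pcons a x)) * phi (pcons a x)).

(* The relation "L_A^*(mu) = mu'": a finite Borel measure on a metric space is
   determined by the integrals of the continuous functions. *)
Definition dual_transfer (nu : probability (borel M) R) (A : B -> R)
    (mu mu' : {measure set (borel B) -> \bar R}) : Prop :=
  forall phi : B -> R, continuous phi ->
    (\int[mu']_x (phi x)%:E = \int[mu]_x (transfer nu A phi x)%:E)%E.

Definition main_eigen (nu : probability (borel M) R) (alpha : R)
    (A : B -> R) (lam : R) (psi : B -> R) : Prop :=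
  [/\ 0 < lam, holder alpha psi, forall x, 0 < psi x,
      (forall x, psi x <= 1) /\ (exists x, psi x = 1) &
      forall x, transfer nu A psi x = lam * psi x].

Definition normalization (A : B -> R) (lam : R) (psi : B -> R) : B -> R :=
  fun x => A x + ln (psi x) - ln (psi (shift x)) - ln lam.

Definition shift_invariant (mu : {measure set (borel B) -> \bar R}) : Prop :=
  forall E : set (borel B), measurable E -> mu (shift @^-1` E) = mu E.

End transfer_operator.

Definition msupport (R : realType) (T : ptopologicalType)
    (mu : {measure set (borel T) -> \bar R}) : set T :=
  [set a | forall U : set T, open U -> U a -> (0 < mu U)%E].

(* The measure f mu with density f with respect to mu. *)
Section mdensity.
Context d {T : measurableType d} {R : realType}.
Variables (mu : {measure set T -> \bar R}) (f : T -> R).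
Hypotheses (f_ge0 : forall x, 0 <= f x) (mf : measurable_fun setT f).

Definition mdensity of (forall x, 0 <= f x) & measurable_fun setT f :=
  fun E : set T => (\int[mu]_(x in E) (f x)%:E)%E.

Local Notation dens := (mdensity f_ge0 mf).

Let mdensity0 : dens set0 = 0%E.
Proof. by rewrite /mdensity integral_set0. Qed.

Let mdensity_ge0 E : (0 <= dens E)%E.
Proof. by apply: integral_ge0 => x _; rewrite lee_fin. Qed.

Let mdensity_sigma_additive : semi_sigma_additive dens.
Proof.
move=> F mF tF mUF; rewrite /mdensity ge0_integral_bigcup//; last first.
- by move=> x _; rewrite lee_fin.
- by apply/measurable_EFinP; exact: measurable_funTS.
by apply: is_cvg_ereal_nneg_natsum => n _; exact: mdensity_ge0.
Qed.

HB.instance Definition _ := isMeasure.Build _ _ _ dens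
  mdensity0 mdensity_ge0 mdensity_sigma_additive.

End mdensity.

Lemma continuous_holder (R : realType) (M : compactMetricType R) (alpha : R)
  (f : seqspace M -> R) : 0 < alpha -> holder alpha f -> continuous f.
Proof.
move=> alpha0 [C HC] x.
apply/(@cvgrPdist_lt _ _ _ _ (nbhs_filter (x : seqspace M))) => e e0.
have C0 : 0 < `|C| + 1 by rewrite ltr_wpDl.
have r0 : 0 < (e / (`|C| + 1)) `^ alpha^-1 by rewrite powR_gt0// divr_gt0.
have := @nbhsx_ballx R (seqspace M) x _ r0.
apply: filterS => y; rewrite ballEmdist/= => xy.
apply: le_lt_trans (HC x y) _.
have dlt : mdist x y `^ alpha < e / (`|C| + 1).
  have -> : e / (`|C| + 1) = ((e / (`|C| + 1)) `^ alpha^-1) `^ alpha.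
    by rewrite -powRrM mulVf ?gt_eqF// powRr1// divr_ge0 ?ltW.
  by apply: gt0_ltr_powR; rewrite ?nnegrE ?mdist_ge0 ?powR_ge0.
apply: le_lt_trans (_ : _ <= (`|C| + 1) * mdist x y `^ alpha) _.
  by apply: ler_wpM2r; rewrite ?powR_ge0// ler_wpDr// ler_norm.
by rewrite mulrC -ltr_pdivlMr.
Qed.

Section main_eigen_inverse.
Context {R : realType} {M : compactMetricType R}.
Variables (nu : probability (borel M) R) (alpha lam : R).
Variables (A psi : seqspace M -> R).
Hypotheses (alpha01 : 0 < alpha <= 1) (psiP : main_eigen nu alpha A lam psi).

Lemma main_eigen_lam_ge0 : 0 <= lam.
Proof. by case: psiP => /ltW. Qed.

Lemma main_eigen_inv_ge0 (x : borel (seqspace M)) : 0 <= (psi x)^-1.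
Proof. by case: psiP => _ _ psi0 _ _; rewrite invr_ge0 ltW. Qed.

Lemma main_eigen_inv_measurable :
  measurable_fun [set: borel (seqspace M)] (fun x => (psi x)^-1 : R).
Proof.
case: psiP => _ hpsi psi0 _ _; case/andP: alpha01 => alpha0 _.
have cpsi : continuous (fun x : seqspace M => (psi x)^-1 : R).
  move=> x; apply: (@cvgV _ _ _ (nbhs_filter (x : seqspace M))).
    by rewrite gt_eqF.
  exact: continuous_holder hpsi x.
apply: (measurability _ (RGenOpens.measurableE R)).
move=> _ [_ [a [b ->] <-]]; rewrite setTI; apply: sub_sigma_algebra.
by move/continuousP : cpsi; apply; exact: interval_open.
Qed.

End main_eigen_inverse.

(* Main.v *)
Require Import Defs.
From HB Require Import structures.
From mathcomp Require Import all_boot all_order all_algebra.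
From mathcomp Require Import all_classical all_reals all_analysis.
From mathcomp Require Import measurable_realfun ring lra.

(** The normalized operator P is an average: P w (x) is the mean of w (pcons a x)
    over the letters a, for a probability whose density exp(Abar) varies by a
    factor at most exp(K d(x,y)^alpha) between two points x and y. Two mechanisms
    make P contract: the inverse branches [pcons a] halve distances, and the
    averages seen from x and y share a common part. Measuring functions by moduli
    of continuity s (1 - exp(-C d(x,y)^alpha)), with C large, turns both into a
    single strict contraction ([transfer_one_sided],
    [transfer_iter_contraction]). Hence the oscillation of the iterates of a
    Lipschitz function decays exponentially; as Lipschitz functions are dense
    ([lipschitz_approx]), the iterates of every continuous function converge
    uniformly to a constant ([transfer_iter_cvg]).

    The limit constant is a positive normalized linear functional of the
    function, hence the integral against a probability mu. The representation
    theorem used for this ([riesz_representation]) is proved for compact metric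
    spaces by Caratheodory's method, and applies because the space of sequences
    is compact ([seqspace_compact]).

    That the iterates of each continuous w converge uniformly to the integral of
    w (the predicate [attracting]) contains all the assertions on mu: it is fixed
    by the dual operator because a sequence and its translate have the same limit,
    any other fixed probability has the same integrals because it integrates all
    the iterates alike, and it is shift invariant because P (f o shift) = f.

    Finally, the operator of A is conjugated to the normalized one:
    L_A w = lam psi P (w / psi) ([transfer_conjugation]). Dividing by psi carries
    the statements about P and mu to those about A and rho. *)

Set Implicit Arguments.
Unset Strict Implicit.
Unset Printing Implicit Defensive.

Import Order.TTheory GRing.Theory Num.Theory.
Import numFieldNormedType.Exports.

Local Open Scope classical_set_scope.
Local Open Scope ring_scope.

(** * Continuous functions on a compact metric space *)

Section continuous_functions.
Context {R : realType} {T : compactMetricType R}.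
Implicit Types (f g : T -> R) (mu : probability (borel T) R).

Lemma continuous_mdistP f : continuous f <->
  forall x e, 0 < e -> exists2 d, 0 < d &
    forall y, mdist x y < d -> `|f x - f y| < e.
Proof.
split=> [cf x e e0|H x].
  have /cvgrPdist_lt/(_ e e0) := cf x.
  move=> /nbhs_ballP[d /= d0 H]; exists d => // y xy.
  by apply: H; rewrite ballEmdist.
apply/cvgrPdist_lt => e e0; have [d d0 H'] := H x e e0.
by apply/nbhs_ballP; exists d => // y; rewrite ballEmdist; exact: H'.
Qed.

Lemma lipschitz_continuous f (L : R) :
  (forall x y, `|f x - f y| <= L * mdist x y) -> continuous f.
Proof.
move=> H; apply/continuous_mdistP => x e e0.
have L0 : 0 < `|L| + 1 by rewrite ltr_wpDl.
exists (e / (`|L| + 1)) => [|y]; first by rewrite divr_gt0.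
rewrite ltr_pdivlMr// mulrC; apply: le_lt_trans; apply: le_trans (H x y) _.
by rewrite ler_wpM2r ?mdist_ge0// ler_wpDr// ler_norm.
Qed.

Lemma continuous_add f g :
  continuous f -> continuous g -> continuous (fun x => f x + g x).
Proof. by move=> cf cg x; exact: cvgD (cf x) (cg x). Qed.

Lemma continuous_sub f g :
  continuous f -> continuous g -> continuous (fun x => f x - g x).
Proof. by move=> cf cg x; exact: cvgB (cf x) (cg x). Qed.

Lemma continuous_mul f g :
  continuous f -> continuous g -> continuous (fun x => f x * g x).
Proof. by move=> cf cg x; exact: cvgM (cf x) (cg x). Qed.

Lemma continuous_minr f g :
  continuous f -> continuous g -> continuous (fun x => Num.min (f x) (g x)).
Proof. by move=> cf cg x; apply: continuous_min; [exact: cf|exact: cg]. Qed.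

Lemma continuous_absr f : continuous f -> continuous (fun x => `|f x|).
Proof. by move=> cf x; apply: cvg_norm; exact: cf. Qed.

Lemma continuous_comp_real f (h : R -> R) :
  continuous h -> continuous f -> continuous (fun x => h (f x)).
Proof. by move=> ch cf x; apply: continuous_comp; [exact: cf|exact: ch]. Qed.

Lemma continuous_bounded f : continuous f ->
  exists2 N : R, 0 < N & forall x, `|f x| <= N.
Proof.
move=> cf.
have cn : {within [set: T], continuous (fun x => `|f x|)}.
  by apply: continuous_subspaceT => x; apply: cvg_norm; exact: cf.
have [c _ H] := compact_EVT_max (ex_intro _ point I) (@compact_setT R T) cn.
exists (`|f c| + 1) => [|x]; first by rewrite ltr_wpDl.
by rewrite ler_wpDr// H// inE.
Qed.

Lemma continuous_borel_measurable f : continuous f ->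
  measurable_fun [set: borel T] (f : borel T -> R).
Proof.
move=> cf; apply: (measurability _ (RGenOpens.measurableE R)).
move=> _ [_ [a [b ->] <-]]; rewrite setTI; apply: sub_sigma_algebra.
by move/continuousP : cf; apply; exact: interval_open.
Qed.

Lemma continuous_integrable mu f : continuous f ->
  mu.-integrable [set: borel T] (EFin \o f).
Proof.
move=> cf; apply: measurable_bounded_integrable => //.
- by rewrite (le_lt_trans (probability_le1 mu measurableT)) ?ltry.
- exact: continuous_borel_measurable.
have [N N0 H] := continuous_bounded cf.
exists N; split; first by rewrite num_real.
by move=> M NM x _ /=; rewrite (le_trans (H x)) ?ltW.
Qed.

Lemma continuous_integral_fin mu f : continuous f ->
  (\int[mu]_x (f x)%:E)%E = (\int[mu]_x f x)%:E.
Proof.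
move=> cf; rewrite /Rintegral fineK//.
by apply: integrable_fin_num => //; exact: continuous_integrable.
Qed.

Lemma continuous_unif f : continuous f -> forall e, 0 < e ->
  exists2 d, 0 < d & forall x y, mdist x y < d -> `|f x - f y| < e.
Proof.
move=> cf e e0.
have := @compact_setT R T; rewrite compact_near_coveringP.
move=> /(_ R (0^'+) (fun r x => forall y, mdist x y < r -> `|f x - f y| < e)).
move=> /(_ (at_right_proper_filter _)).
case.
  move=> x _; have e2 : 0 < e / 2 by rewrite divr_gt0.
  have [d d0 H] := (continuous_mdistP f).1 cf x _ e2.
  have d2 : 0 < d / 2 by rewrite divr_gt0.
  exists (ball x (d/2), [set r | 0 < r <= d/2]).
    split; first exact: nbhsx_ballx.
    exists (d/2) => //= r /=; rewrite sub0r normrN => + r0.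
    by rewrite gtr0_norm// => /ltW ->; rewrite r0.
  move=> [x' r] /= [bx /andP[r0 rd]] y x'y.
  have xx' : mdist x x' < d / 2 by move: bx; rewrite ballEmdist.
  rewrite (splitr e) -(subrK (f x) (f x')) -addrA (le_lt_trans (ler_normD _ _))//.
  rewrite ltrD//; last first.
    apply: H; rewrite (le_lt_trans (metric_triangle x x' y))// (splitr d).
    by rewrite ltrD// (lt_le_trans x'y).
  rewrite distrC; apply: H; rewrite (lt_trans xx')// ltr_pdivrMr//.
  by rewrite ltr_pMr// ltr1n.
move=> d /= d0 H; exists (d / 2); first by rewrite divr_gt0.
move=> x y xy; have d2 : 0 < d / 2 by rewrite divr_gt0.
apply: (H (d/2) _ d2 x I y xy); rewrite /= sub0r normrN gtr0_norm//.
by rewrite ltr_pdivrMr// ltr_pMr// ltr1n.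
Qed.

Lemma mdist_lipschitz (x y z : T) : `|mdist x z - mdist y z| <= mdist x y.
Proof.
rewrite ler_norml !lerBlDr metric_triangle andbT.
by rewrite lerNl opprB lerBlDr (metric_sym x y) metric_triangle.
Qed.

Lemma mdist_bounded : exists2 D : R, 0 < D & forall x y : T, mdist x y <= D.
Proof.
have cd : continuous (fun x : T => mdist x point).
  apply: (@lipschitz_continuous _ 1) => x y; rewrite mul1r.
  exact: mdist_lipschitz.
have [N N0 H] := continuous_bounded cd.
exists (N + N) => [|x y]; first by rewrite addr_gt0.
rewrite (le_trans (metric_triangle x point y))// lerD//.
  by rewrite (le_trans (ler_norm _)).
by rewrite metric_sym (le_trans (ler_norm _)).
Qed.

(** The inf-convolution [inf_y (f y + L d(x, y))] is L-Lipschitz and lies below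
    f; uniform continuity controls f at short distances and boundedness at long
    ones, so it is uniformly close to f once L is large. *)
Lemma lipschitz_approx f : continuous f -> forall e, 0 < e ->
  exists (g : T -> R) (L : R),
    [/\ 0 <= L, forall x y, `|g x - g y| <= L * mdist x y &
        forall x, `|f x - g x| <= e].
Proof.
move=> cf e e0.
have [N N0 fN] := continuous_bounded cf.
have [d d0 fd] := continuous_unif cf e0.
pose L := (N + N) / d.
have L0 : 0 <= L by rewrite divr_ge0// ?addr_ge0 ?ltW.
have fL x y : f x <= f y + L * mdist x y + e.
  have [xyd|dxy] := ltP (mdist x y) d.
    have := fd _ _ xyd; rewrite ltr_norml => /andP[_].
    have := mulr_ge0 L0 (mdist_ge0 x y); lra.
  have := fN x; have := fN y; rewrite !ler_norml => /andP[fy _] /andP[_ fx].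
  have : N + N <= L * mdist x y.
    rewrite -mulrA -ler_pdivrMl ?addr_gt0// mulVf ?gt_eqF ?addr_gt0//.
    by rewrite ler_pdivlMl ?mulr1.
  move: fx fy e0; lra.
pose S x := [set f y + L * mdist x y | y in [set: T]].
have S0 x : S x !=set0 by exists (f x + L * mdist x x); exists x.
have lbS x : lbound (S x) (f x - e).
  by move=> _ [y _ <-]; rewrite lerBlDr fL.
have hS x : has_inf (S x) by split => //; exists (f x - e); exact: lbS.
have gle x y : inf (S x) <= inf (S y) + L * mdist x y.
  rewrite -lerBlDr; apply: lb_le_inf => // _ [z _ <-].
  rewrite lerBlDr; apply: (@le_trans _ _ (f z + L * mdist x z)).
    by apply: ge_inf; [exact: (hS x).2|exists z].
  rewrite -addrA lerD2l -mulrDr ler_wpM2l// addrC.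
  exact: metric_triangle.
exists (fun x => inf (S x)), L; split => //.
  move=> x y; rewrite ler_norml lerNl opprB !lerBlDl.
  by rewrite gle andbT metric_sym gle.
move=> x; rewrite ler_norml; apply/andP; split.
  rewrite lerNl opprB lerBlDr; apply: (@le_trans _ _ (f x + L * mdist x x)).
    by apply: ge_inf; [exact: (hS x).2|exists x].
  by rewrite mdistxx mulr0 addr0 lerDr ltW.
by rewrite lerBlDr addrC -lerBlDr; exact: (lb_le_inf (S0 x) (lbS x)).
Qed.

(** The functions are [min 1 (n r)] with r the distance to the complement of U.
    At a point of U they reach the value 1 after finitely many steps, not only in
    the limit, so that their products with majorants still exceed 1 there. *)
Lemma open_lipschitz_indicator (U : set T) : open U -> exists h : nat -> T -> R,
  [/\ forall n, exists L : R, forall x y, `|h n x - h n y| <= L * mdist x y,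
      forall n x, 0 <= h n x <= 1,
      forall x, {homo h ^~ x : m n / (m <= n)%N >-> m <= n},
      forall n x, ~ U x -> h n x = 0 &
      forall x, U x -> exists N, forall n, (N <= n)%N -> h n x = 1].
Proof.
move=> oU.
have [D D0 dD] := mdist_bounded.
(* Capping the distance at D keeps the set S x nonempty when U is the whole
   space. *)
pose S x := [set Num.min D (mdist x y) | y in ~` U] `|` [set D].
have S0 x : S x !=set0 by exists D; right.
have lbS x : lbound (S x) 0.
  by move=> _ [[y _ <-]|->]; [rewrite le_min mdist_ge0 ltW|exact: ltW].
have hS x : has_inf (S x) by split => //; exists 0; exact: lbS.
pose r x := inf (S x).
have r0 x : 0 <= r x by exact: lb_le_inf.
have rle x y : r x <= r y + mdist x y.
  rewrite -lerBlDr; apply: lb_le_inf => // _ [[z Uz <-]|->].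
    rewrite lerBlDr; apply: (@le_trans _ _ (Num.min D (mdist x z))).
      by apply: ge_inf; [exact: (hS x).2|left; exists z].
    by rewrite !min_r ?dD// addrC metric_triangle.
  rewrite lerBlDr; apply: (@le_trans _ _ D).
    by apply: ge_inf; [exact: (hS x).2|right].
  by rewrite lerDl mdist_ge0.
have rL x y : `|r x - r y| <= mdist x y.
  by rewrite ler_norml lerNl opprB !lerBlDl rle andbT metric_sym rle.
have rU x : ~ U x -> r x = 0.
  move=> Ux; apply/eqP; rewrite eq_le r0 andbT.
  apply: (@le_trans _ _ (Num.min D (mdist x x))).
    by apply: ge_inf; [exact: (hS x).2|left; exists x].
  by rewrite mdistxx ge_min lexx orbT.
have rpos x : U x -> 0 < r x.
  move=> Ux; have /nbhs_ballP[d /= d0 dU] : nbhs x U by exact: open_nbhs_nbhs.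
  apply: (@lt_le_trans _ _ (Num.min D d)); first by rewrite lt_min D0.
  apply: lb_le_inf => // _ [[y Uy <-]|->]; last by rewrite ge_min lexx.
  rewrite le_min ge_min lexx/= ge_min orbC.
  have [//|/=] := leP d (mdist x y).
  by move=> xy; exfalso; apply/Uy/dU; rewrite ballEmdist.
exists (fun n x => Num.min 1 (n%:R * r x)); split => //.
- move=> n; exists n%:R => x y.
  apply: (@le_trans _ _ `|n%:R * r x - n%:R * r y|); last first.
    by rewrite -mulrBr normrM ger0_norm// ler_wpM2l.
  set a := n%:R * r x; set b := n%:R * r y.
  have ab (u v : R) : Num.min 1 u - Num.min 1 v <= `|u - v|.
    rewrite lerBlDr; have [v1|v1] := leP 1 v.
      by rewrite ge_min lerDr normr_ge0.
    by rewrite ge_min -[X in _ || X]lerBlDr ler_norm orbT.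
  by rewrite ler_norml ab andbT lerNl opprB distrC ab.
- by move=> n x; rewrite ge_min lexx le_min ler01 mulr_ge0.
- move=> x m n mn; rewrite le_min ge_min lexx/= ge_min; apply/orP; right.
  by rewrite ler_wpM2r// ler_nat.
- by move=> n x /rU ->; rewrite mulr0 min_r.
- move=> x /rpos rx; exists (Num.truncn (r x)^-1).+1 => n Nn.
  apply/min_l; rewrite -ler_pdivrMr// mul1r.
  rewrite (le_trans (ltW (truncnS_gt _)))// ler_nat//.
Qed.

(** The open sets form a pi-system generating the Borel sets, and the measure of
    an open set is the limit of the integrals of Lipschitz functions increasing
    to its indicator. *)
Lemma eq_measure_lipschitz (mu mu' : probability (borel T) R) :
  (forall (f : T -> R) (L : R), (forall x y, `|f x - f y| <= L * mdist x y) ->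
     \int[mu]_x f x = \int[mu']_x f x) ->
  forall E : set (borel T), measurable E -> mu E = mu' E.
Proof.
move=> H X mX; apply: (@measure_unique _ R (borel T) (@open T) (fun=> setT)) => //.
- by move=> A B; exact: openI.
- by move=> _; exact: openT.
- by rewrite bigcup_const.
- move=> U oU.
  have mU : measurable (U : set (borel T)) by exact: sub_sigma_algebra.
  have [h [hL h01 hnd h0 h1]] := open_lipschitz_indicator oU.
  have ch n : continuous (h n).
    by have [L HL] := hL n; exact: lipschitz_continuous HL.
  have E (P : probability (borel T) R) :
      (\int[P]_x (h n x)%:E)%E @[n --> \oo] --> P U.
    rewrite -(setIT U) -integral_indic//.
    have -> : (\int[P]_x (\1_U x)%:E = \int[P]_x limn (fun n => (h n x)%:E))%E.
      apply: eq_integral => x _; apply/esym/cvg_lim => //.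
      have [Ux|nUx] := pselect (U x).
        have [N HN] := h1 _ Ux; rewrite indicE mem_set//.
        by apply: cvg_near_cst; exists N => // n /= Nn; rewrite HN.
      rewrite indicE memNset//; apply: cvg_near_cst; apply: nearW => n.
      by rewrite h0.
    apply: cvg_monotone_convergence => //.
    - by move=> n; apply/measurable_EFinP; exact: continuous_borel_measurable.
    - by move=> n x _; rewrite lee_fin; case/andP: (h01 n x).
    - by move=> x _ m n mn; rewrite lee_fin hnd.
  have e n : (\int[mu]_x (h n x)%:E = \int[mu']_x (h n x)%:E)%E.
    have [L HL] := hL n.
    by rewrite !continuous_integral_fin// (H _ _ HL).
  apply: (cvg_unique (@ereal_hausdorff R) (E mu)).
  by rewrite (funext e); exact: E.
- by move=> _; rewrite (le_lt_trans (probability_le1 mu measurableT)) ?ltry.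
Qed.

End continuous_functions.

(** * The representation theorem on compact metric spaces *)

Record positive_functional (R : realType) (T : compactMetricType R) :=
  PositiveFunctional {
    functional :> (T -> R) -> R ;
    functionalD : forall f g : T -> R, continuous f -> continuous g ->
      functional (fun x => f x + g x) = functional f + functional g ;
    functionalZ : forall (c : R) (f : T -> R), continuous f ->
      functional (fun x => c * f x) = c * functional f ;
    functional_ge0 : forall f : T -> R, continuous f -> (forall x, 0 <= f x) ->
      0 <= functional f ;
    functional1 : functional (fun=> 1) = 1 }.

Section riesz.
Context {R : realType} {T : compactMetricType R}.
Variable Lam : positive_functional T.
Implicit Types (f g : T -> R) (E : set T).

Lemma functional_cst (c : R) : Lam (fun=> c) = c.
Proof.
rewrite -[RHS]mulr1 -(functional1 Lam) -functionalZ; last exact: cst_continuous.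
by congr (functional _ _); apply/funext => x; rewrite mulr1.
Qed.

Lemma functionalB f g : continuous f -> continuous g ->
  Lam (fun x => f x - g x) = Lam f - Lam g.
Proof.
move=> cf cg; rewrite -mulN1r -functionalZ// -functionalD//; last first.
  by apply: continuous_mul => //; exact: cst_continuous.
by congr (functional _ _); apply/funext => x; rewrite mulN1r.
Qed.

Lemma le_functional f g : continuous f -> continuous g ->
  (forall x, f x <= g x) -> Lam f <= Lam g.
Proof.
move=> cf cg fg; rewrite -subr_ge0 -functionalB//.
by apply: functional_ge0 => [|x]; [exact: continuous_sub|rewrite subr_ge0].
Qed.

Lemma continuous_sumr (n : nat) (F : nat -> T -> R) :
  (forall i, continuous (F i)) -> continuous (fun x => \sum_(i < n) F i x).
Proof.
move=> cF; elim: n => [|n IH].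
  rewrite (_ : (fun x => _) = fun=> 0); first exact: cst_continuous.
  by apply/funext => x; rewrite big_ord0.
rewrite (_ : (fun x => _) = fun x => \sum_(i < n) F i x + F n x).
  exact: continuous_add.
by apply/funext => x; rewrite big_ord_recr.
Qed.

Lemma functional_sum (n : nat) (F : nat -> T -> R) :
  (forall i, continuous (F i)) ->
  Lam (fun x => \sum_(i < n) F i x) = \sum_(i < n) Lam (F i).
Proof.
move=> cF; elim: n => [|n IH].
  rewrite big_ord0 -[RHS](functional_cst 0).
  by congr (functional _ _); apply/funext => x; rewrite big_ord0.
rewrite big_ord_recr/= -IH -functionalD//; last exact: continuous_sumr.
by congr (functional _ _); apply/funext => x; rewrite big_ord_recr.
Qed.

(** An increasing sequence of nonnegative continuous functions that exceeds 1 at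
    each point of E plays the part of an open set containing E. Working with
    functions instead of open sets makes additivity of the outer measure a direct
    consequence of the linearity of the functional. *)
Definition majorant_costs E : set R := [set c | exists g : nat -> T -> R,
  [/\ forall n, continuous (g n), forall n x, 0 <= g n x,
      forall x, {homo g ^~ x : m n / (m <= n)%N >-> m <= n},
      forall x, E x -> exists n, 1 <= g n x & forall n, Lam (g n) <= c]].

Definition riesz_outer E : R := inf (majorant_costs E).

Lemma cost_function f c E : continuous f -> (forall x, 0 <= f x) ->
  (forall x, E x -> 1 <= f x) -> Lam f <= c -> majorant_costs E c.
Proof.
move=> cf f0 fE fc; exists (fun=> f).
by split=> [n|n x|x m n _|x /fE fx|n] //; exists 0%N.
Qed.

Lemma majorant_costs1 E : majorant_costs E 1.
Proof.
by apply: (@cost_function (fun=> 1)) => //; [exact: cst_continuous|rewrite functional1].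
Qed.

Lemma majorant_costs_ge0 E : lbound (majorant_costs E) 0.
Proof.
by move=> c [g [cg g0 _ _ /(_ 0)]]; apply: le_trans; exact: functional_ge0.
Qed.

Lemma has_inf_majorant_costs E : has_inf (majorant_costs E).
Proof.
by split; [exists 1; exact: majorant_costs1|exists 0; exact: majorant_costs_ge0].
Qed.

Lemma riesz_outer_le E c : majorant_costs E c -> riesz_outer E <= c.
Proof. by move=> Ec; apply: ge_inf => //; case: (has_inf_majorant_costs E). Qed.

Lemma riesz_outer_ge E c : lbound (majorant_costs E) c -> c <= riesz_outer E.
Proof. by apply: lb_le_inf; case: (has_inf_majorant_costs E). Qed.

Definition riesz_mu E : \bar R := (riesz_outer E)%:E.

Lemma riesz_mu0 : riesz_mu set0 = 0%E.
Proof.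
congr EFin; apply/eqP; rewrite eq_le riesz_outer_ge ?andbT//.
  apply: riesz_outer_le; apply: (@cost_function (fun=> 0)) => //.
    exact: cst_continuous.
  by rewrite functional_cst.
exact: majorant_costs_ge0.
Qed.

Lemma riesz_mu_ge0 E : (0 <= riesz_mu E)%E.
Proof. by rewrite lee_fin riesz_outer_ge//; exact: majorant_costs_ge0. Qed.

Lemma le_riesz_mu : {homo riesz_mu : A B / A `<=` B >-> (A <= B)%E}.
Proof.
move=> A B AB; rewrite lee_fin; apply: riesz_outer_ge => c [g [cg g0 gnd gB gc]].
by apply: riesz_outer_le; exists g; split => // x /AB; exact: gB.
Qed.

(** If (g i n) majorizes (F i), the partial sums of the diagonal,
    [sum_(i < n) g i n], increase and majorize the union. *)
Lemma riesz_mu_sigma_subadditive : sigma_subadditive riesz_mu.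
Proof.
move=> F; apply/lee_addgt0Pr => e e0.
apply: le_trans (epsilon_trick xpredT _ (ltW e0)); last first.
  by move=> n; exact: riesz_mu_ge0.
pose a i := riesz_outer (F i) + e / (2 ^ i.+1)%:R.
have e2 i : 0 < e / (2 ^ i.+1)%:R by rewrite divr_gt0// ltr0n expn_gt0.
have a0 i : 0 <= a i.
  by rewrite addr_ge0 ?(ltW (e2 i))// -lee_fin; exact: riesz_mu_ge0.
rewrite (_ : (fun n => _) = fun n => (\sum_(0 <= i < n) (a i)%:E)%E); last first.
  by apply/funext => n; apply: eq_bigr => i _; rewrite EFinD.
case S : (\sum_(0 <= i <oo) (a i)%:E)%E => [s| |]; last 2 first.
- by rewrite leey.
- have : (0 <= \sum_(0 <= i <oo) (a i)%:E)%E.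
    by apply: nneseries_ge0 => n _ _; rewrite lee_fin.
  by rewrite S.
have cF i : exists c, majorant_costs (F i) c /\ c < a i.
  have [c Fc ca] := inf_adherent (e2 i) (has_inf_majorant_costs (F i)).
  by exists c; split.
have gF i : exists g : nat -> T -> R,
  [/\ forall n, continuous (g n), forall n x, 0 <= g n x,
      forall x, {homo g ^~ x : m n / (m <= n)%N >-> m <= n},
      forall x, F i x -> exists n, 1 <= g n x & forall n, Lam (g n) <= a i].
  have [c [[g [cg g0 gnd gFi gc]] ca]] := cF i.
  by exists g; split => // n; rewrite (le_trans (gc n)) ?ltW.
have [g gP] := choice gF.
rewrite lee_fin; apply: riesz_outer_le.
exists (fun n x => \sum_(i < n) g i n x); split.
- move=> n; apply: (@continuous_sumr n (fun i => g i n)) => i.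
  by have [+ _ _ _ _] := gP i.
- by move=> n x; apply: sumr_ge0 => i _; have [_ + _ _ _] := gP i.
- move=> x m n mn; rewrite -(big_mkord xpredT (fun i => g i m x)).
  rewrite -(big_mkord xpredT (fun i => g i n x)) [leRHS](big_cat_nat (leq0n m) mn)/=.
  rewrite -[leLHS]addr0 lerD//.
    by apply: ler_sum => i _; have [_ _ + _ _] := gP i; exact.
  by apply: sumr_ge0 => i _; have [_ + _ _ _] := gP i.
- move=> x [i _ Fix]; have [_ g0 gnd /(_ x Fix)[n gn] _] := gP i.
  exists (maxn i.+1 n); have im : (i < maxn i.+1 n)%N by rewrite leq_max leqnn.
  rewrite (bigD1 (Ordinal im))//= (le_trans gn)//.
  apply: (le_trans (gnd x _ _ (leq_maxr i.+1 n))).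
  by rewrite lerDl; apply: sumr_ge0 => j _; have [_ + _ _ _] := gP j.
- move=> n; rewrite (@functional_sum n (fun i => g i n)); last first.
    by move=> i; have [+ _ _ _ _] := gP i.
  rewrite -lee_fin -S; apply: le_trans; last first.
    by apply: (@nneseries_lim_ge _ _ xpredT 0 n) => i _ _; rewrite lee_fin.
  rewrite big_mkord sumEFin lee_fin; apply: ler_sum => i _.
  by have [_ _ _ _] := gP i; exact.
Qed.

HB.instance Definition _ := isOuterMeasure.Build R T riesz_mu
  riesz_mu0 riesz_mu_ge0 le_riesz_mu riesz_mu_sigma_subadditive.

(** With h_n increasing to the indicator of U, a majorant g_n of X splits: the
    sequence (g_n h_n) majorizes the part of X inside U, and for each fixed n the
    sequence (g_m (1 - h_n))_m majorizes the part outside U. *)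
Lemma open_caratheodory (U : set T) :
  open U -> riesz_mu.-caratheodory U.
Proof.
move=> oU; apply: le_caratheodory_measurable => X.
rewrite -EFinD lee_fin.
have [h [hL h01 hnd h0 h1]] := open_lipschitz_indicator oU.
have ch n : continuous (h n).
  by have [L HL] := hL n; exact: lipschitz_continuous HL.
have ch' n : continuous (fun x => 1 - h n x).
  by apply: continuous_sub => //; exact: cst_continuous.
have hge0 n x : 0 <= h n x by case/andP: (h01 n x).
have hle1 n x : h n x <= 1 by case/andP: (h01 n x).
apply: riesz_outer_ge => c [g [cg g0 gnd gX gc]].
rewrite -lerBrDr; apply: riesz_outer_le.
exists (fun n x => g n x * h n x); split.
- by move=> n; exact: continuous_mul.
- by move=> n x; rewrite mulr_ge0.
- by move=> x m n mn; rewrite ler_pM// ?gnd ?hnd.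
- move=> x [/gX[n gn] /h1[m hm]]; exists (maxn n m).
  by rewrite hm ?leq_maxr// mulr1 (le_trans gn)// gnd// leq_maxl.
move=> n; rewrite lerBrDr -lerBrDl; apply: riesz_outer_le.
exists (fun m x => g (m + n)%N x * (1 - h n x)); split.
- by move=> m; exact: continuous_mul.
- by move=> m x; rewrite mulr_ge0// subr_ge0.
- by move=> x k m km; rewrite ler_wpM2r ?subr_ge0// gnd// leq_add2r.
- move=> x [/gX[m gm] Ux]; exists m.
  by rewrite h0// subr0 mulr1 (le_trans gm)// gnd// leq_addr.
move=> m; rewrite lerBrDl; apply: le_trans (gc (m + n)%N).
have -> : Lam (g (m + n)%N) = Lam (fun x => g (m + n)%N x * h n x) +
    Lam (fun x => g (m + n)%N x * (1 - h n x)).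
  rewrite -functionalD; [|exact: continuous_mul..].
  by congr (functional _ _); apply/funext => x; rewrite -mulrDr addrC subrK mulr1.
rewrite lerD2r; apply: le_functional; [exact: continuous_mul..|].
by move=> x; rewrite ler_wpM2r// gnd// leq_addl.
Qed.

Lemma borel_caratheodory (E : set (borel T)) :
  measurable E -> riesz_mu.-cara.-measurable E.
Proof.
apply: (smallest_sub
  (@sigma_algebra_measurable _ (caratheodory_type riesz_mu))).
by move=> U oU; exact: open_caratheodory.
Qed.

(** Here compactness enters: an increasing sequence of continuous functions that
    exceeds 1 at each point exceeds 1 - e everywhere from some rank on. *)
Lemma riesz_mu_setT : riesz_mu setT = 1%E.
Proof.
congr EFin; apply/eqP; rewrite eq_le riesz_outer_le/=; last first.
  exact: majorant_costs1.
apply: riesz_outer_ge => c [g [cg g0 gnd gT gc]].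
apply/ler_addgt0Pr => e e0; rewrite -lerBlDr.
have := @compact_setT R T; rewrite compact_near_coveringP.
move=> /(_ nat \oo (fun n x => 1 - e <= g n x)) [|N _ HN].
  move=> x _; have [n gn] := gT x I.
  have [d d0 H] := (continuous_mdistP (g n)).1 (cg n) x e e0.
  exists (ball x d, [set m | (n <= m)%N]).
    by split; [exact: nbhsx_ballx|exists n].
  move=> [y m] /= [by_ nm].
  have xy : mdist x y < d by move: by_; rewrite ballEmdist.
  apply: (le_trans _ (gnd y _ _ nm)).
  have := H y xy; rewrite ltr_norml => /andP[_]; move: gn; lra.
apply: le_trans (gc N); rewrite -(functional_cst (1 - e)).
apply: le_functional => [| |x]; [exact: cst_continuous|exact: cg|].
exact: (HN N (leqnn N) x I).
Qed.

Definition riesz_measure (E : set (borel T)) : \bar R := riesz_mu E.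

Lemma riesz_measure_sigma_additive : semi_sigma_additive riesz_measure.
Proof.
move=> F mF tF mUF.
apply: (@caratheodory_measure_sigma_additive R T riesz_mu) => //.
  by move=> i; exact: borel_caratheodory.
exact: borel_caratheodory.
Qed.

HB.instance Definition _ := isMeasure.Build _ _ _ riesz_measure
  riesz_mu0 riesz_mu_ge0 riesz_measure_sigma_additive.

HB.instance Definition _ := Measure_isProbability.Build _ _ _ riesz_measure
  riesz_mu_setT.

Lemma riesz_markov_ineq f (d : R) : continuous f -> (forall x, 0 <= f x) ->
  0 < d -> d * riesz_outer [set x | d <= f x] <= Lam f.
Proof.
move=> cf f0 d0; rewrite mulrC -ler_pdivlMr//; apply: riesz_outer_le.
apply: (@cost_function (fun x => d^-1 * f x)) => //.
- by apply: continuous_mul => //; exact: cst_continuous.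
- by move=> x; rewrite mulr_ge0// invr_ge0 ltW.
- by move=> x /= dx; rewrite mulrC ler_pdivlMr// mul1r.
- by rewrite functionalZ// mulrC.
Qed.

(** The layers s_k = min(f, (k+1) d) - min(f, k d) take values in [0, d], and
    s_{k+1} vanishes where s_k < d. Hence the integral of s_{k+1} is at most d
    times the measure of {s_k = d}, which is at most the functional at s_k. Summing
    over k costs one extra layer, that is, an error d. *)
Lemma riesz_integral_truncation f (d : R) (n : nat) : continuous f ->
  (forall x, 0 <= f x) -> 0 < d ->
  \int[riesz_measure]_x Num.min (f x) (n.+1%:R * d) <=
    d + Lam (fun x => Num.min (f x) (n%:R * d)).
Proof.
move=> cf f0 d0.
pose m k x := Num.min (f x) (k%:R * d).
have cm k : continuous (m k).
  by apply: continuous_minr => //; exact: cst_continuous.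
pose s k x := m k.+1 x - m k x.
have cs k : continuous (s k) by exact: continuous_sub.
have kd k : k.+1%:R * d = k%:R * d + d by rewrite -natr1 mulrDl mul1r.
have s0 k x : 0 <= s k x.
  rewrite /s /m subr_ge0 le_min ge_min lexx/= ge_min kd.
  by rewrite lerDl (ltW d0) orbT.
have sd k x : s k x <= d.
  rewrite /s /m kd; case: (leP (f x) (k%:R * d));
    case: (leP (f x) (k%:R * d + d)); move: d0; lra.
have sS k x : s k.+1 x <= d * \1_[set y | d <= s k y] x.
  rewrite indicE; have [dx|dx] := leP d (s k x); first by rewrite mem_set// mulr1.
  rewrite memNset/=; last by apply/negP; rewrite -ltNge.
  move: dx; rewrite mulr0 /s /m (kd k.+1) !(kd k).
  case: (leP (f x) (k%:R * d)); case: (leP (f x) (k%:R * d + d));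
    case: (leP (f x) (k%:R * d + d + d)); move: d0; lra.
rewrite -/(m n.+1) -/(m n); elim: n => [|n IH].
  rewrite -[leLHS]/(\int[riesz_measure]_x m 1 x).
  apply: (@le_trans _ _ (\int[riesz_measure]_(x in setT) d)).
    apply: le_Rintegral => //; try exact: continuous_integrable.
      by apply: continuous_integrable; exact: cst_continuous.
    by move=> x _; rewrite /m mul1r ge_min lexx orbT.
  rewrite Rintegral_cst// [fine _](_ : _ = 1); last first.
    by rewrite [X in fine X]riesz_mu_setT.
  rewrite mulr1 lerDl; apply: functional_ge0 => // x.
  by rewrite /m mul0r le_min f0 lexx.
have -> : \int[riesz_measure]_x Num.min (f x) (n.+2%:R * d) =
    \int[riesz_measure]_x m n.+1 x + \int[riesz_measure]_x s n.+1 x.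
  rewrite -RintegralD//; [|exact: continuous_integrable..].
  by apply: eq_Rintegral => x _; rewrite /s addrC subrK.
have -> : Lam (m n.+1) = Lam (m n) + Lam (s n).
  by rewrite [Lam (s n)]functionalB// addrC subrK.
rewrite addrA lerD//.
have ms : measurable ([set y | d <= s n y] : set (borel T)).
  rewrite -[X in measurable X]setTI.
  have := continuous_borel_measurable (cs n).
  move/(_ measurableT `[d, +oo[%classic (measurable_itv _)).
  by rewrite preimage_itvcy.
apply: le_trans (riesz_markov_ineq (cs n) (s0 n) d0).
apply: (@le_trans _ _ (\int[riesz_measure]_x (d * \1_[set y | d <= s n y] x))).
  apply: le_Rintegral => //; first exact: continuous_integrable.
  apply: measurable_bounded_integrable => //.
  - by rewrite (le_lt_trans (probability_le1 riesz_measure measurableT)) ?ltry.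
  - by apply: measurable_funM => //; exact: measurable_indic.
  exists d; split; first by rewrite num_real.
  move=> M dM x _ /=; rewrite indicE normrM ger0_norm ?(ltW d0)//.
  by case: (_ \in _); rewrite ?normr1 ?normr0 ?mulr1 ?mulr0 ltW// (lt_trans d0).
rewrite /Rintegral; under eq_integral do rewrite EFinM.
rewrite integralZl//; last first.
  by apply: integrable_indic => //;
    rewrite (le_lt_trans (probability_le1 riesz_measure measurableT)) ?ltry.
by rewrite integral_indic// setIT.
Qed.

Lemma riesz_integral_le f : continuous f -> (forall x, 0 <= f x) ->
  \int[riesz_measure]_x f x <= Lam f.
Proof.
move=> cf f0; have [N N0 fN] := continuous_bounded cf.
apply/ler_addgt0Pl => e e0.
pose n := (Num.truncn (N / e)).+1.
have fne (k : nat) x : (n <= k)%N -> Num.min (f x) (k%:R * e) = f x.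
  move=> nk; apply/min_l; rewrite (le_trans (ler_norm _))// (le_trans (fN x))//.
  rewrite -ler_pdivrMr// (le_trans (ltW (truncnS_gt _)))// ler_nat.
  exact: leq_trans nk.
have := riesz_integral_truncation n cf f0 e0.
rewrite (_ : (fun x => Num.min (f x) (n%:R * e)) = f); last first.
  by apply/funext => x; exact: fne.
apply: le_trans; rewrite le_eqVlt; apply/orP; left; apply/eqP.
by apply: eq_Rintegral => x _; rewrite fne.
Qed.

(** Both N + f and N - f are nonnegative, so the inequality of the previous lemma
    holds in both directions. *)
Lemma riesz_integral f : continuous f ->
  \int[riesz_measure]_x f x = Lam f.
Proof.
move=> cf; have [N N0 fN] := continuous_bounded cf.
have cN : continuous (fun _ : T => N) by exact: cst_continuous.
have iN : \int[riesz_measure]_x N = N.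
  rewrite Rintegral_cst// [fine _](_ : _ = 1) ?mulr1//.
  by rewrite [X in fine X]riesz_mu_setT.
have := @riesz_integral_le (fun x => N - f x) (continuous_sub cN cf).
have := @riesz_integral_le (fun x => N + f x) (continuous_add cN cf).
rewrite functionalD// functionalB// functional_cst.
rewrite RintegralD//; try exact: continuous_integrable.
rewrite RintegralB//; try exact: continuous_integrable.
rewrite iN lerD2l lerD2l lerN2 => le1 le2; apply/eqP; rewrite eq_le le1 ?le2//.
  by move=> x; rewrite subr_ge0 (le_trans (ler_norm _)).
by move=> x; rewrite -lerBlDl sub0r lerNl (le_trans (ler_norm _))// normrN.
Qed.

End riesz.

Theorem riesz_representation (R : realType) (T : compactMetricType R)
    (Lam : positive_functional T) :
  exists mu : probability (borel T) R,
    forall f : T -> R, continuous f -> \int[mu]_x f x = Lam f.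
Proof. by exists (riesz_measure Lam) => f; exact: riesz_integral. Qed.

(** * The space of sequences *)

Local Notation shift := Defs.shift.

Section seqspace_topology.
Context {R : realType} {M : compactMetricType R}.
Local Notation B := (seqspace M).
Implicit Types x y : B.

Lemma seqdist_term_le (D : R) x y n : (forall a b : M, mdist a b <= D) ->
  seqdist_term x y n <= 2 ^- n.+1 * D.
Proof. by move=> HD; rewrite ler_wpM2l// invr_ge0 exprn_ge0. Qed.

Lemma seqdist_term_ge0 x y n : 0 <= seqdist_term x y n.
Proof. by rewrite mulr_ge0// ?mdist_ge0// invr_ge0 exprn_ge0. Qed.

Lemma series_seqdist_le (D : R) x y n : (forall a b : M, mdist a b <= D) ->
  series (seqdist_term x y) n <= D.
Proof.
move=> HD; have D0 : 0 <= D by rewrite (le_trans (mdist_ge0 (x 0%N) (y 0%N))).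
suff : series (seqdist_term x y) n <= D - 2 ^- n * D.
  by move=> /le_trans; apply; rewrite gerBl mulr_ge0// invr_ge0 exprn_ge0.
elim: n => [|n IH]; first by rewrite /series/= big_geq// expr0 invr1 mul1r subrr.
rewrite /series/= big_nat_recr//= (le_trans (lerD IH (seqdist_term_le x y n HD)))//.
rewrite exprS invfM; set u := (2 ^+ n)^-1; rewrite le_eqVlt; apply/orP; left.
by apply/eqP; field.
Qed.

Lemma is_cvg_seqdist x y : cvgn (series (seqdist_term x y)).
Proof.
have [D _ HD] := @mdist_bounded R M.
apply: nondecreasing_is_cvgn.
  by apply: nondecreasing_series => n _ _; exact: seqdist_term_ge0.
by exists D => _ [n _ <-]; exact: series_seqdist_le.
Qed.

Lemma seqspace_mdist_le (D : R) x y : (forall a b : M, mdist a b <= D) ->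
  mdist x y <= D.
Proof.
move=> HD; apply: limr_le; first exact: is_cvg_seqdist.
by apply: nearW => n; exact: series_seqdist_le.
Qed.

(** This self-similarity is what makes the inverse branches [pcons a] halve
    distances. *)
Lemma seqspace_mdistS x y :
  mdist x y = (mdist (x 0%N) (y 0%N) + mdist (shift x) (shift y)) / 2.
Proof.
have c1 := @is_cvg_seqdist (shift x) (shift y).
rewrite -[LHS]/(limn (series (seqdist_term x y))).
rewrite -[mdist (shift x) _]/(limn (series (seqdist_term (shift x) (shift y)))).
apply: cvg_lim => //; rewrite -cvg_shiftS /=.
rewrite [X in X @ _](_ : _ =
  fun n => (mdist (x 0%N) (y 0%N) + series (seqdist_term (shift x) (shift y)) n) / 2).
  by apply: cvgMl; apply: cvgD => //; exact: cvg_cst.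
apply/funext => n; rewrite /series/= big_nat_recl//= mulrDl; congr (_ + _).
  by rewrite /seqdist_term expr1 mulrC.
rewrite mulr_suml; apply: eq_bigr => i _.
by rewrite /seqdist_term /shift [in LHS]exprS invfM -mulrA mulrC.
Qed.

Lemma mdist_pcons (a b : M) x y :
  mdist (pcons a x) (pcons b y) = (mdist a b + mdist x y) / 2.
Proof. by rewrite seqspace_mdistS. Qed.

Lemma mdist_shift x y : mdist (shift x) (shift y) <= 2 * mdist x y.
Proof.
rewrite (seqspace_mdistS x y) mulrCA mulfV ?pnatr_eq0// mulr1.
by rewrite lerDr mdist_ge0.
Qed.

(** The identity from the product space, compact by Tychonoff, is continuous for
    the metric, because sequences with close initial segments are close. *)
Lemma seqspace_compact : compact [set: B].
Proof.
have [D D0 HD] := @mdist_bounded R M.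
have prefix (e : R) k x y : 0 <= e ->
    (forall i, (i < k)%N -> mdist (x i) (y i) < e) ->
    mdist x y <= e + D / 2 ^+ k.
  move=> e0; elim: k x y => [|k IH] x y xy.
    by rewrite expr0 divr1 (le_trans (seqspace_mdist_le x y HD))// lerDr.
  rewrite seqspace_mdistS.
  have := IH (shift x) (shift y) (fun i ik => xy i.+1 ik).
  have := xy 0%N isT.
  rewrite exprS invfM mulrCA; move: (D / 2 ^+ k) => u; lra.
have -> : [set: B] = (id : prod_topology (fun _ : nat => M) -> B) @` setT.
  by apply/seteqP; split => // x _; exists x.
apply: continuous_compact; last first.
  have := @tychonoff nat (fun=> M) (fun=> setT) (fun=> compact_setT).
  by congr compact; apply/seteqP; split.
apply: continuous_subspaceT => x U.
move=> /(@nbhs_ballP R B)[e /= e0 xU].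
change (nbhs (x : prod_topology (fun _ : nat => M)) U).
have e4 : 0 < e / 4 by rewrite divr_gt0.
pose k := (Num.truncn (D / (e / 4))).+1.
have Dk : D / 2 ^+ k < e / 4.
  rewrite ltr_pdivrMr ?exprn_gt0// mulrC -ltr_pdivrMr//.
  rewrite (lt_le_trans (truncnS_gt _))// -natrX ler_nat.
  exact/ltnW/ltn_expl.
pose P : topologicalType := prod_topology (fun _ : nat => M).
have FF : Filter (nbhs (x : P)) by exact: (@nbhs_filter P x).
have H : nbhs (x : P) [set y | forall i, (i < k)%N -> mdist (x i) (y i) < e / 4].
  elim: k {Dk} => [|k IH]; first by apply: (@filterS _ _ FF setT) => //; exact: filterT.
  have : nbhs (x : P) [set y | mdist (x k) (y k) < e / 4].
    have := @proj_continuous nat (fun=> M) k x _ (nbhsx_ballx (x k) _ e4).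
    by apply: (@filterS _ _ FF) => y /=; rewrite ballEmdist.
  move: IH; apply: filterS2 => y yi yk i.
  by rewrite ltnS leq_eqVlt => /predU1P[->//|]; exact: yi.
move: H; apply: (@filterS _ _ FF) => y /(prefix _ _ _ _ (ltW e4)) xy; apply: xU.
rewrite ballEmdist/=; apply: le_lt_trans xy _.
by move: Dk e0; move: (D / 2 ^+ k) => u; lra.
Qed.

End seqspace_topology.

HB.instance Definition _ (R : realType) (M : compactMetricType R) :=
  isCompactMetric.Build R (seqspace M) seqspace_compact.

(** * Contraction by the transfer operator *)

Section transfer_basics.
Context {R : realType} {M : compactMetricType R}.
Local Notation B := (seqspace M).
Variable nu : probability (borel M) R.
Implicit Types (A phi w : B -> R) (x y : B).

Lemma continuous_pcons w x : continuous w -> continuous (fun a : M => w (pcons a x)).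
Proof.
move=> cw; apply/continuous_mdistP => a e e0.
have [d d0 H] := (continuous_mdistP w).1 cw (pcons a x) e e0.
exists d => // b ab; apply: H; rewrite mdist_pcons mdistxx addr0.
by have := mdist_ge0 a b; move: ab; lra.
Qed.

Lemma continuous_expRM A phi : continuous A -> continuous phi ->
  continuous (fun x => expR (A x) * phi x).
Proof.
move=> cA cphi; apply: continuous_mul => //.
by apply: (continuous_comp_real _ cA); exact: continuous_expR.
Qed.

Lemma transfer_integrable A phi x : continuous A -> continuous phi ->
  nu.-integrable setT
    (EFin \o (fun a : borel M => expR (A (pcons a x)) * phi (pcons a x))).
Proof.
move=> cA cphi; apply: continuous_integrable.
by apply: (@continuous_pcons (fun x => expR (A x) * phi x)); exact: continuous_expRM.
Qed.

Lemma transferD A phi w : continuous A -> continuous phi -> continuous w ->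
  transfer nu A (fun x => phi x + w x) =
  fun x => transfer nu A phi x + transfer nu A w x.
Proof.
move=> cA cphi cw; apply/funext => x; rewrite /transfer -RintegralD//;
  [|exact: transfer_integrable..].
by apply: eq_Rintegral => a _; rewrite mulrDr.
Qed.

Lemma transferZ A (c : R) phi : continuous A -> continuous phi ->
  transfer nu A (fun x => c * phi x) = fun x => c * transfer nu A phi x.
Proof.
move=> cA cphi; apply/funext => x; rewrite /transfer -RintegralZl//;
  last exact: transfer_integrable.
by apply: eq_Rintegral => a _; rewrite mulrCA.
Qed.

Lemma le_transfer A phi w : continuous A -> continuous phi -> continuous w ->
  (forall x, phi x <= w x) -> forall x, transfer nu A phi x <= transfer nu A w x.
Proof.
move=> cA cphi cw pw x; apply: le_Rintegral => //; try exact: transfer_integrable.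
by move=> a _; rewrite ler_wpM2l ?expR_ge0.
Qed.

Lemma transfer_continuous A phi : continuous A -> continuous phi ->
  continuous (transfer nu A phi).
Proof.
move=> cA cphi; apply/continuous_mdistP => x e e0.
have ch := continuous_expRM cA cphi.
have e2 : 0 < e / 2 by rewrite divr_gt0.
have [d d0 H] := continuous_unif ch e2.
exists d => // y xy; rewrite /transfer -RintegralB//; [|exact: transfer_integrable..].
have ci : continuous (fun a : M => expR (A (pcons a x)) * phi (pcons a x) -
    expR (A (pcons a y)) * phi (pcons a y)).
  by apply: continuous_sub;
    exact: (@continuous_pcons (fun x => expR (A x) * phi x)).
apply: le_lt_trans (le_normr_Rintegral measurableT (continuous_integrable nu ci)) _.
apply: (@le_lt_trans _ _ (\int[nu]_(a in setT) (e / 2))).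
  apply: le_Rintegral => //.
  - by apply: (@continuous_integrable R M) => a; apply: cvg_norm; exact: ci.
  - by apply: (@continuous_integrable R M); exact: cst_continuous.
  - move=> a _; apply/ltW/H; rewrite mdist_pcons mdistxx add0r.
    by have := mdist_ge0 x y; move: xy; lra.
rewrite Rintegral_cst// [fine _](_ : _ = 1); last first.
  by rewrite [X in fine X]probability_setT.
by rewrite mulr1 ltr_pdivrMr// ltr_pMr// ltr1n.
Qed.

Lemma transfer_iter_continuous A phi n : continuous A -> continuous phi ->
  continuous (iter n (transfer nu A) phi).
Proof. by move=> cA cphi; elim: n => //= n; exact: transfer_continuous. Qed.

End transfer_basics.

(** As [t |-> 1 - exp (-t)] is concave and vanishes at 0, slowing time by a factor
    rho < 1 multiplies it, uniformly on bounded intervals, by a factor less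
    than 1. *)
Lemma expR_contraction (R : realType) (rho t T : R) : 0 < rho < 1 -> 0 <= t <= T ->
  1 - expR (- (rho * t)) <= (1 - (1 - rho) * expR (- T)) * (1 - expR (- t)).
Proof.
move=> /andP[r0 r1] /andP[t0 tT].
have h1 : expR (- t) * (1 + (1 - rho) * t) <= expR (- (rho * t)).
  rewrite (_ : - (rho * t) = - t + (1 - rho) * t); last by ring.
  by rewrite expRD ler_wpM2l ?expR_ge0// expR_ge1Dx.
have h2 : 1 - expR (- t) <= t by have := expR_ge1Dx (- t); lra.
have h3 : expR (- T) <= expR (- t) by rewrite ler_expR lerN2.
have h4 : expR (- T) * (1 - expR (- t)) <= expR (- t) * t.
  apply: (@le_trans _ _ (expR (- T) * t)); first by rewrite ler_wpM2l ?expR_ge0.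
  by rewrite ler_wpM2r.
have : (1 - rho) * (expR (- T) * (1 - expR (- t))) <= (1 - rho) * (expR (- t) * t).
  by rewrite ler_wpM2l// subr_ge0 ltW.
move: h1; move: (expR (- t)) (expR (- T)) (expR (- (rho * t))) => a b c; lra.
Qed.

Section contraction.
Context {R : realType} {M : compactMetricType R}.
Local Notation B := (seqspace M).
Variables (nu : probability (borel M) R) (alpha : R) (G : B -> R).
Hypotheses (alpha01 : 0 < alpha <= 1) (hG : holder alpha G).
Hypothesis G1 : forall x, transfer nu G (fun=> 1) x = 1.
Implicit Types (w phi : B -> R) (x y : B).
Local Notation P := (transfer nu G).

Let cG : continuous G.
Proof. by case/andP: alpha01 => a0 _; exact: continuous_holder hG. Qed.

Let theta : R := 2^-1 `^ alpha.

Let theta01 : 0 < theta < 1.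
Proof.
case/andP: alpha01 => a0 _; rewrite powR_gt0 ?invr_gt0//=.
have e1 : 1 `^ alpha = 1 :> R by rewrite powR1.
by rewrite -[ltRHS]e1; apply: gt0_ltr_powR => //;
  rewrite ?nnegrE ?invr_ge0// invf_lt1 ?ltr1n.
Qed.

Definition hdist x y : R := mdist x y `^ alpha.

Lemma hdist_ge0 x y : 0 <= hdist x y.
Proof. exact: powR_ge0. Qed.

Lemma hdist_pcons (a : M) x y : hdist (pcons a x) (pcons a y) = theta * hdist x y.
Proof.
by rewrite /hdist mdist_pcons mdistxx add0r mulrC powRM ?invr_ge0// mdist_ge0.
Qed.

Lemma transfer_cst (c : R) : P (fun=> c) = fun=> c.
Proof.
rewrite (_ : (fun=> c) = fun x : B => c * 1); last first.
  by apply/funext => x; rewrite mulr1.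
rewrite transferZ//; last exact: cst_continuous.
by apply/funext => x; rewrite G1.
Qed.

(** A coupling of the two averages. Write p and q for the weights seen from x and
    from y. Since p >= m q with m = exp(-K theta r), a proportion m of the two
    averages can be taken with the same letter a, where the values of w differ by
    at most s (1 - exp(-C theta r)); on the remaining proportion 1 - m the
    difference is at most s. The total is
    s (1 - m exp(-C theta r)), again of the form s (1 - exp(-C' r)). *)
Lemma transfer_one_sided (K C s : R) w x y : continuous w -> 0 <= s ->
  (forall x y, `|G x - G y| <= K * hdist x y) ->
  (forall x y, w x - w y <= s * (1 - expR (- (C * hdist x y)))) ->
  P w x - P w y <= s * (1 - expR (- ((K + C) * theta * hdist x y))).
Proof.
move=> cw s0 GK wC.
set r := hdist x y.
pose m := expR (- (K * theta * r)).
pose om := 1 - expR (- (C * (theta * r))).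
pose p (a : M) := expR (G (pcons a x)) * 1.
pose q (a : M) := expR (G (pcons a y)) * 1.
pose u (a : M) := expR (G (pcons a x)) * w (pcons a x).
pose v (a : M) := expR (G (pcons a y)) * w (pcons a y).
have c1 : continuous (fun _ : B => 1 : R) by exact: cst_continuous.
have ip : \int[nu]_a p a = 1 by exact: G1.
have iq : \int[nu]_a q a = 1 by exact: G1.
have intp : nu.-integrable setT (EFin \o p).
  exact: (@transfer_integrable _ _ nu G (fun=> 1) x cG c1).
have intq : nu.-integrable setT (EFin \o q).
  exact: (@transfer_integrable _ _ nu G (fun=> 1) y cG c1).
have intu : nu.-integrable setT (EFin \o u) by exact: transfer_integrable.
have intv : nu.-integrable setT (EFin \o v) by exact: transfer_integrable.
rewrite -[P w x]/(\int[nu]_a u a) -[P w y]/(\int[nu]_a v a).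
set I := \int[nu]_a v a.
have iZ (c : R) (f : borel M -> R) : nu.-integrable setT (EFin \o f) ->
    nu.-integrable setT (EFin \o (fun a => c * f a)).
  move=> fi; rewrite (_ : EFin \o _ = fun a => (c%:E * (EFin \o f) a)%E).
    exact: (integrableZl measurableT c fi).
  by apply/funext => b; rewrite /= EFinM.
have iD (f g : borel M -> R) : nu.-integrable setT (EFin \o f) ->
    nu.-integrable setT (EFin \o g) ->
    nu.-integrable setT (EFin \o (fun a => f a + g a)).
  move=> fi gi; rewrite (_ : EFin \o _ = ((EFin \o f) \+ (EFin \o g))%E).
    exact: (integrableD measurableT fi gi).
  by apply/funext => b; rewrite /= EFinD.
have wI a : w (pcons a x) <= s + I.
  have : \int[nu]_a0 ((w (pcons a x) - s) * q a0) <= I.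
    apply: le_Rintegral => //; first exact: iZ.
    move=> b _; rewrite /q /v mulr1 mulrC ler_wpM2l ?expR_ge0//.
    have := wC (pcons a x) (pcons b y).
    have : s * (1 - expR (- (C * hdist (pcons a x) (pcons b y)))) <= s.
      by rewrite ler_piMr// gerBl expR_ge0.
    by lra.
  rewrite RintegralZl// iq mulr1; lra.
have mq a : m * q a <= p a.
  rewrite /m /q /p !mulr1 -expRD ler_expR.
  have := GK (pcons a y) (pcons a x); rewrite hdist_pcons ler_norml => /andP[_].
  by rewrite /r /hdist (metric_sym x y) mulrA; lra.
have wuv a : w (pcons a x) <= w (pcons a y) + s * om.
  by have := wC (pcons a x) (pcons a y); rewrite hdist_pcons -/r -/om; lra.
have pw a : u a <= m * v a + (m * (s * om - (s + I))) * q a + (s + I) * p a.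
  have m0 : 0 <= m * q a by rewrite /q mulr1 mulr_ge0 ?expR_ge0.
  rewrite -/(u a).
  have -> : u a = m * q a * w (pcons a x) + (p a - m * q a) * w (pcons a x).
    by rewrite /u /p; ring.
  have e1 : m * q a * w (pcons a x) <= m * q a * (w (pcons a y) + s * om).
    by rewrite ler_wpM2l.
  have e2 : (p a - m * q a) * w (pcons a x) <= (p a - m * q a) * (s + I).
    by rewrite ler_wpM2l// subr_ge0.
  rewrite (le_trans (lerD e1 e2))// le_eqVlt; apply/orP; left; apply/eqP.
  by rewrite /v /q; ring.
have : \int[nu]_a u a <=
    \int[nu]_a (m * v a + (m * (s * om - (s + I))) * q a + (s + I) * p a).
  apply: le_Rintegral => //; apply: (iD _ _); [apply: (iD _ _)|]; exact: iZ.
rewrite RintegralD//; [|apply: (iD _ _); exact: iZ|exact: iZ].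
rewrite RintegralD//; [|exact: iZ..].
rewrite !RintegralZl// ip iq -/I !mulr1.
have -> : expR (- ((K + C) * theta * r)) = m * (1 - om).
  by rewrite /om subKr /m -expRD; congr expR; ring.
by move: (\int[nu]_a u a) => J; lra.
Qed.

(** Moduli of continuity of the form 1 - exp(-C r) measure at once the Hoelder
    constant (small r) and the oscillation (large r), and one application of the
    operator replaces C by (K + C) theta. For C large this is rho C with rho < 1,
    which is a strict contraction in one step. *)
Lemma transfer_iter_contraction : exists kappa C : R,
  [/\ 0 <= kappa < 1, 0 < C & forall w s, continuous w -> 0 <= s ->
    (forall x y, w x - w y <= s * (1 - expR (- (C * hdist x y)))) ->
    forall n x y, iter n P w x - iter n P w y <=
      kappa ^+ n * s * (1 - expR (- (C * hdist x y)))].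
Proof.
have [K0 GK0] := hG.
have [D D0 dD] := @mdist_bounded R (seqspace M).
have /andP[th0 th1] := theta01.
pose K := `|K0| + 1.
have K0' : 0 < K by rewrite ltr_wpDl.
have GK x y : `|G x - G y| <= K * hdist x y.
  rewrite (le_trans (GK0 x y))// ler_wpM2r ?hdist_ge0//.
  by rewrite ler_wpDr// ler_norm.
(* C is the solution of (K + C) theta = rho C; any rho between theta and 1 would
   do. *)
pose rho := (1 + theta) / 2.
have rho01 : 0 < rho < 1 by rewrite /rho; apply/andP; split; lra.
have rth : 0 < rho - theta by rewrite /rho; lra.
pose C := K * theta / (rho - theta).
have C0 : 0 < C by rewrite /C divr_gt0// mulr_gt0.
have KC : (K + C) * theta = rho * C.
  by rewrite /C; field; rewrite gt_eqF.
pose T := C * (D `^ alpha).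
have hT x y : 0 <= C * hdist x y <= T.
  rewrite mulr_ge0 ?hdist_ge0 ?(ltW C0)//= ler_wpM2l ?(ltW C0)//.
  case/andP: alpha01 => a0 _.
  by rewrite ge0_ler_powR ?nnegrE ?(ltW a0) ?mdist_ge0 ?(ltW D0).
have /andP[rho0 rho1] := rho01.
have eT0 := expR_gt0 (- T).
have eT1 : expR (- T) <= 1.
  by rewrite -[leRHS]expR0 ler_expR oppr_le0 /T mulr_ge0 ?(ltW C0)// powR_ge0.
exists (1 - (1 - rho) * expR (- T)), C; split => //.
  have : (1 - rho) * expR (- T) <= (1 - rho) * 1.
    by rewrite ler_wpM2l// subr_ge0 ltW.
  have : 0 < (1 - rho) * expR (- T) by rewrite mulr_gt0// subr_gt0.
  by move=> *; apply/andP; split; lra.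
set kappa := 1 - _.
have kappa0 : 0 <= kappa.
  have : (1 - rho) * expR (- T) <= (1 - rho) * 1.
    by rewrite ler_wpM2l// subr_ge0 ltW.
  by rewrite /kappa; lra.
move=> w s cw s0 wC; elim=> [|n IH] x y; first by rewrite expr0 mul1r.
have sn : 0 <= kappa ^+ n * s by rewrite mulr_ge0// exprn_ge0.
have cn := @transfer_iter_continuous _ _ nu _ _ n cG cw.
have := transfer_one_sided x y cn sn GK IH.
move=> /le_trans; apply.
have -> : kappa ^+ n.+1 * s * (1 - expR (- (C * hdist x y))) =
    kappa ^+ n * s * (kappa * (1 - expR (- (C * hdist x y)))).
  by rewrite exprS; ring.
by rewrite KC -(mulrA rho) ler_wpM2l//; exact: (expR_contraction rho01 (hT x y)).
Qed.

(** On the bounded interval where r = d(x,y)^alpha ranges, d(x,y) is at most a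
    multiple of r, and r at most a multiple of 1 - exp(-C r). *)
Lemma lipschitz_hdist (L C : R) w : 0 < C ->
  (forall x y, `|w x - w y| <= L * mdist x y) ->
  exists2 s, 0 <= s &
    forall x y, w x - w y <= s * (1 - expR (- (C * hdist x y))).
Proof.
move=> C0 wL.
have [D D0 dD] := @mdist_bounded R (seqspace M).
case/andP: alpha01 => a0 a1.
have dh x y : mdist x y <= D `^ (1 - alpha) * hdist x y.
  have [d0|d0] := eqVneq (mdist x y) 0.
    by rewrite d0 mulr_ge0 ?powR_ge0.
  rewrite -[leLHS]powRr1 ?mdist_ge0// -{1}(subrK alpha 1) powRD; last first.
    by rewrite subrK oner_eq0.
  rewrite ler_wpM2r ?powR_ge0// ge0_ler_powR ?nnegrE ?mdist_ge0 ?(ltW D0)//.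
  by rewrite subr_ge0.
pose T := C * (D `^ alpha).
have hT x y : C * hdist x y <= T.
  rewrite ler_wpM2l ?(ltW C0)//.
  by rewrite ge0_ler_powR ?nnegrE ?(ltW a0) ?mdist_ge0 ?(ltW D0).
exists (`|L| * D `^ (1 - alpha) * expR T / C).
  by rewrite divr_ge0 ?(ltW C0)// !mulr_ge0 ?powR_ge0 ?expR_ge0.
move=> x y; set h := hdist x y.
have h1 : h <= expR T / C * (1 - expR (- (C * h))).
  rewrite mulrAC ler_pdivlMr// mulrC.
  have h2 : C * h * expR (- (C * h)) <= 1 - expR (- (C * h)).
    have := expR_ge1Dx (C * h).
    rewrite -(ler_pM2r (expR_gt0 (- (C * h)))) -expRD subrr expR0; lra.
  apply: (@le_trans _ _ (expR T * (C * h * expR (- (C * h))))); last first.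
    by rewrite ler_wpM2l ?expR_ge0.
  rewrite mulrCA -expRD ler_peMr ?mulr_ge0 ?hdist_ge0 ?(ltW C0)//.
  by rewrite -[leLHS]expR0 ler_expR subr_ge0 hT.
apply: le_trans (ler_norm _) _; apply: le_trans (wL x y) _.
apply: (@le_trans _ _ (`|L| * (D `^ (1 - alpha) * h))).
  apply: (@le_trans _ _ (`|L| * mdist x y)).
    by rewrite ler_wpM2r ?mdist_ge0// ler_norm.
  by rewrite ler_wpM2l// dh.
rewrite -!mulrA ler_wpM2l// ler_wpM2l ?powR_ge0//.
by rewrite !mulrA in h1 *.
Qed.

Lemma transfer_iter_cst (c : R) n : iter n P (fun=> c) = fun=> c.
Proof. by elim: n => //= n ->; rewrite transfer_cst. Qed.

Lemma le_transfer_iter (c : R) phi w n : continuous phi -> continuous w ->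
  (forall x, phi x <= w x + c) -> forall x, iter n P phi x <= iter n P w x + c.
Proof.
move=> cphi cw pw; elim: n => //= n IH x.
have cc : continuous (fun _ : B => c) by exact: cst_continuous.
have cn := @transfer_iter_continuous _ _ nu _ _ n cG cw.
apply: (@le_trans _ _ (P (fun x => iter n P w x + c) x)).
  apply: le_transfer => //; first exact: transfer_iter_continuous.
  exact: continuous_add.
by rewrite transferD// transfer_cst.
Qed.

(** For Lipschitz functions the contraction gives exponential decay. The iterates
    do not increase the uniform distance, so by density the oscillation of every
    continuous function tends to 0. *)
Lemma transfer_iter_osc w : continuous w -> forall e, 0 < e ->
  exists N, forall n, (N <= n)%N -> forall x y, iter n P w x - iter n P w y <= e.
Proof.
move=> cw e e0.
have e3 : 0 < e / 3 by rewrite divr_gt0.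
have [g [L [L0 gL wg]]] := lipschitz_approx cw e3.
have cg := lipschitz_continuous gL.
have [kappa [C [/andP[k0 k1] C0 H]]] := transfer_iter_contraction.
have [s s0 gs] := lipschitz_hdist C0 gL.
have : (kappa ^+ n * s) @[n --> \oo] --> 0 * s.
  by apply: cvgMl; apply: cvg_expr; rewrite ger0_norm.
rewrite mul0r => /cvgrPdist_le /(_ _ e3)[N _ HN].
exists N => n /HN /=; rewrite sub0r normrN ger0_norm ?mulr_ge0 ?exprn_ge0// => kn x y.
have h1 := H g s cg s0 gs n x y.
have h2 : kappa ^+ n * s * (1 - expR (- (C * hdist x y))) <= kappa ^+ n * s.
  by rewrite ler_piMr ?mulr_ge0 ?exprn_ge0// gerBl expR_ge0.
have h3 := le_transfer_iter n cw cg (c := e / 3).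
have h4 := le_transfer_iter n cg cw (c := e / 3).
have {}h3 : iter n P w x <= iter n P g x + e / 3.
  by apply: h3 => z; have := wg z; rewrite ler_norml => /andP[_]; lra.
have {}h4 : iter n P g y <= iter n P w y + e / 3.
  by apply: h4 => z; have := wg z; rewrite ler_norml => /andP[+ _]; lra.
by move: h1 h2 h3 h4 kn; lra.
Qed.

(** All later iterates take their values between the extreme values of a given
    one; as these get close, the iterates at a point form a Cauchy sequence. *)
Lemma transfer_iter_cvg w : continuous w ->
  exists l : R, forall e, 0 < e -> exists N, forall n, (N <= n)%N ->
    forall x, `|iter n P w x - l| <= e.
Proof.
move=> cw; pose a n := iter n P w point.
have osc e : 0 < e -> exists N, forall n, (N <= n)%N ->
    forall x, `|iter n P w x - a N| <= e.
  move=> e0; have [N HN] := transfer_iter_osc cw e0.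
  exists N => n Nn x; rewrite -(subnK Nn) iterD.
  have cN := @transfer_iter_continuous _ _ nu _ _ N cG cw.
  have ca : continuous (fun _ : B => a N) by exact: cst_continuous.
  have h1 := le_transfer_iter (n - N) cN ca (c := e).
  have h2 := le_transfer_iter (n - N) ca cN (c := e).
  rewrite !transfer_iter_cst in h1 h2.
  have {}h1 : iter (n - N) P (iter N P w) x <= a N + e.
    by apply: h1 => z; have := HN N (leqnn N) z point; rewrite -/(a N); lra.
  have {}h2 : a N <= iter (n - N) P (iter N P w) x + e.
    by apply: h2 => z; have := HN N (leqnn N) point z; rewrite -/(a N); lra.
  by rewrite ler_norml; apply/andP; split; lra.
have : cvgn a.
  apply/cauchy_cvgP; apply: cauchy_exP => e e0.
  have e2 : 0 < e / 2 by rewrite divr_gt0.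
  have [N HN] := osc _ e2; exists (a N); exists N => // n /= Nn.
  have := HN n Nn point; rewrite /ball/= distrC => /le_lt_trans; apply.
  by rewrite ltr_pdivrMr// ltr_pMr// ltr1n.
move=> /cvg_ex[l /= al]; exists l => e e0.
have e3 : 0 < e / 3 by rewrite divr_gt0.
have [N HN] := osc _ e3.
move/cvgrPdist_le : al => /(_ _ e3)[N' _ HN'].
exists N => n Nn x.
have h1 := HN n Nn x.
have h2 := HN (maxn N N') (leq_maxl _ _) point.
have h3 := HN' (maxn N N') (leq_maxr _ _).
rewrite -/(a _) in h2.
move: h1 h2 h3; rewrite !ler_norml => /andP[? ?] /andP[? ?] /andP[? ?].
by apply/andP; split; lra.
Qed.

End contraction.

(** * Integration against a density *)

Section density.
Context d {T : measurableType d} {R : realType}.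
Variables (mu : {measure set T -> \bar R}) (f : T -> R).
Hypotheses (f_ge0 : forall x, 0 <= f x) (mf : measurable_fun setT f).
Local Notation dens := (mdensity mu f_ge0 mf).
Local Open Scope ereal_scope.
Import HBNNSimple.

Let mEf : measurable_fun setT (EFin \o f).
Proof. exact/measurable_EFinP. Qed.

Lemma integral_mdensity_nnsfun (h : {nnsfun T >-> R}) :
  \int[dens]_x (h x)%:E = \int[mu]_x ((h x)%:E * (f x)%:E).
Proof.
transitivity (\sum_(r \in range h)
    \int[mu]_x ((r * \1_(h @^-1` [set r]) x)%:E * (f x)%:E)).
  under eq_integral do rewrite fimfunE -fsumEFin//.
  rewrite ge0_integral_fsum//; last 2 first.
  - by move=> r; exact/measurable_EFinP/measurableT_comp.
  - by move=> r x _; rewrite EFinM nnfun_muleindic_ge0.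
  apply: eq_fsbigr => r rh; rewrite integralZl_indic_nnsfun//.
  rewrite integral_indic// setIT.
  have r0 : (0 <= r)%R by move: rh; rewrite inE => -[x _ <-].
  under [RHS]eq_integral do rewrite EFinM -muleA.
  rewrite ge0_integralZl//.
  - congr (_ * _); transitivity (\int[mu]_(x in h @^-1` [set r]) (f x)%:E) => //.
    rewrite integral_mkcond; apply: eq_integral => x _.
    rewrite patchE indicE; case: (_ \in _); first by rewrite mul1e.
    by rewrite mul0e.
  - by apply: emeasurable_funM => //; exact/measurable_EFinP/measurable_indic.
  - by move=> x _; rewrite mule_ge0// lee_fin.
rewrite -ge0_integral_fsum//.
- apply: eq_integral => x _; rewrite -ge0_mule_fsuml; last first.
    by move=> r; rewrite EFinM nnfun_muleindic_ge0.
  by rewrite fsumEFin// -(fimfunE _ x).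
- move=> r; apply: emeasurable_funM => //.
  exact/measurable_EFinP/measurableT_comp.
- by move=> r x _; rewrite mule_ge0// ?lee_fin// -lee_fin EFinM nnfun_muleindic_ge0.
Qed.

Lemma ge0_integral_mdensity (g : T -> \bar R) :
  measurable_fun setT g -> (forall x, 0 <= g x) ->
  \int[dens]_x g x = \int[mu]_x (g x * (f x)%:E).
Proof.
move=> mg g0; pose g_ := nnsfun_approx measurableT mg.
have cg x : (g_ n x)%:E @[n --> \oo] --> g x by exact: cvg_nnsfun_approx.
transitivity (limn (fun n => \int[dens]_x (g_ n x)%:E)).
  rewrite -monotone_convergence//.
  - by apply: eq_integral => x _; apply/esym/cvg_lim => //; exact: cg.
  - by move=> n; exact/measurable_EFinP/measurable_funP.
  - by move=> n x _; rewrite lee_fin.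
  - by move=> x _ m n mn; rewrite lee_fin; exact/lefP/nd_nnsfun_approx.
under eq_fun do rewrite integral_mdensity_nnsfun.
rewrite -monotone_convergence//.
- apply: eq_integral => x _; apply/cvg_lim => //.
  by apply: cvgeZr => //; exact: cg.
- move=> n; apply: emeasurable_funM => //; exact/measurable_EFinP/measurable_funP.
- by move=> n x _; rewrite mule_ge0// lee_fin.
- move=> x _ m n mn; rewrite lee_wpmul2r ?lee_fin//.
  exact/lefP/nd_nnsfun_approx.
Qed.

Lemma integral_mdensity (g : T -> \bar R) : measurable_fun setT g ->
  \int[dens]_x g x = \int[mu]_x (g x * (f x)%:E).
Proof.
move=> mg; rewrite [LHS]integralE [RHS]integralE.
rewrite !ge0_integral_mdensity//;
  [|exact: measurable_funeneg|exact: measurable_funepos].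
congr (_ - _); apply: eq_integral => x _.
  rewrite !funeposE; have [g0|g0] := leP 0 (g x).
    by rewrite !max_l// mule_ge0// lee_fin.
  have gf : g x * (f x)%:E <= 0 by rewrite (mule_le0_ge0 (ltW g0))// lee_fin.
  by rewrite !max_r ?mul0e// ltW.
rewrite !funenegE -mulNe; have [g0|g0] := leP 0 (- g x).
  by rewrite !max_l// mule_ge0// lee_fin.
have gf : (- g x) * (f x)%:E <= 0 by rewrite (mule_le0_ge0 (ltW g0))// lee_fin.
by rewrite !max_r ?mul0e// ltW.
Qed.

End density.

Lemma integral_mscale d (T : measurableType d) (R : realType)
    (mu : {measure set T -> \bar R}) (k : {nonneg R}) (g : T -> \bar R) :
  mu.-integrable setT g ->
  (\int[mscale k mu]_x g x = k%:num%:E * \int[mu]_x g x)%E.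
Proof.
move=> ig; have mg := measurable_int _ ig.
rewrite [LHS]integralE [in RHS]integralE !ge0_integral_mscale//;
  try by [exact: measurable_funeneg|exact: measurable_funepos].
have fn : (\int[mu]_x g^\- x)%E \is a fin_num.
  by apply: integrable_fin_num => //; exact: integrable_funeneg.
by rewrite [RHS]muleBr// fin_num_adde_defl// fin_numN.
Qed.

(** * Hoelder functions on sequences *)

Section holder_functions.
Context {R : realType} {M : compactMetricType R}.
Local Notation B := (seqspace M).
Variables (alpha : R) (alpha0 : 0 < alpha).
Implicit Types (f g : B -> R).

Lemma holderD f g : holder alpha f -> holder alpha g ->
  holder alpha (fun x => f x + g x).
Proof.
move=> [C fC] [D gD]; exists (C + D) => x y.
rewrite opprD addrACA mulrDl (le_trans (ler_normD _ _))// lerD//.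
Qed.

Lemma holderN f : holder alpha f -> holder alpha (fun x => - f x).
Proof. by move=> [C fC]; exists C => x y; rewrite -opprD normrN. Qed.

Lemma holder_cst (c : R) : holder alpha (fun _ : B => c).
Proof. by exists 0 => x y; rewrite subrr normr0 mul0r. Qed.

Lemma holder_shift f : holder alpha f -> holder alpha (f \o shift).
Proof.
move=> [C fC]; exists (`|C| * 2 `^ alpha) => x y /=.
rewrite (le_trans (fC _ _))// (le_trans (ler_wpM2r (powR_ge0 _ _) (ler_norm C)))//.
rewrite -mulrA ler_wpM2l// -powRM ?mdist_ge0//.
by rewrite ge0_ler_powR ?nnegrE ?(ltW alpha0) ?mulr_ge0 ?mdist_ge0// mdist_shift.
Qed.

Lemma ln_lipschitz (c a b : R) : 0 < c -> c <= a -> c <= b ->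
  `|ln a - ln b| <= `|a - b| / c.
Proof.
move=> c0.
have H (u v : R) : c <= u -> c <= v -> ln u - ln v <= `|u - v| / c.
  move=> cu cv; have u0 := lt_le_trans c0 cu; have v0 := lt_le_trans c0 cv.
  rewrite -ln_div ?posrE//.
  have := expR_ge1Dx (ln (u / v)); rewrite lnK ?posrE ?divr_gt0// => h.
  have e : u / v - 1 = (u - v) / v by field; rewrite gt_eqF.
  apply: (@le_trans _ _ ((u - v) / v)); first by rewrite -e; lra.
  apply: (@le_trans _ _ (`|u - v| / v)).
    by rewrite ler_wpM2r ?ler_norm// invr_ge0 ltW.
  by rewrite ler_wpM2l// lef_pV2 ?posrE.
move=> ca cb; rewrite ler_norml H// andbT lerNl opprB distrC; exact: H.
Qed.

Lemma holder_ln f (c : R) : 0 < c -> (forall x, c <= f x) ->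
  holder alpha f -> holder alpha (fun x => ln (f x)).
Proof.
move=> c0 cf [C fC]; exists (C / c) => x y.
rewrite (le_trans (ln_lipschitz c0 (cf x) (cf y)))// mulrAC.
by rewrite ler_wpM2r// invr_ge0 ltW.
Qed.

End holder_functions.

(** * The equilibrium measure of a normalized potential *)

Lemma Rintegral_near_cst (R : realType) (T : compactMetricType R)
    (P : probability (borel T) R) (f : T -> R) (c e : R) : continuous f ->
  (forall x, `|f x - c| <= e) -> `|\int[P]_x f x - c| <= e.
Proof.
move=> cf fc.
have E (u : R) : \int[P]_x u = u.
  rewrite Rintegral_cst// [fine _](_ : _ = 1) ?mulr1//.
  by rewrite [X in fine X]probability_setT.
have cc (u : R) : P.-integrable setT (EFin \o (fun _ : borel T => u)).
  by apply: (@continuous_integrable R T); exact: cst_continuous.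
have cfi := continuous_integrable P cf.
have h1 : \int[P]_x f x <= c + e.
  rewrite -[leRHS]E; apply: le_Rintegral => // x _.
  by have := fc x; rewrite ler_norml => /andP[_]; lra.
have h2 : c - e <= \int[P]_x f x.
  rewrite -[leLHS]E; apply: le_Rintegral => // x _.
  by have := fc x; rewrite ler_norml => /andP[+ _]; lra.
by rewrite ler_norml; apply/andP; split; lra.
Qed.

Section shift_regularity.
Context {R : realType} {M : compactMetricType R}.
Local Notation B := (seqspace M).

Lemma shift_continuous : continuous (shift : B -> B).
Proof.
move=> x U /(@nbhs_ballP R B)[e /= e0 xU]; apply/(@nbhs_ballP R B).
exists (e / 2); first by rewrite /= divr_gt0.
move=> y; rewrite ballEmdist/= => xy; apply: xU; rewrite ballEmdist/=.
by rewrite (le_lt_trans (mdist_shift x y))// mulrC -ltr_pdivlMr.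
Qed.

Lemma measurable_shift : measurable_fun setT (shift : borel B -> borel B).
Proof.
apply: (@measurability _ _ (borel B) (borel B) setT shift (@open B)) => //.
move=> _ [U oU <-]; rewrite setTI.
apply: sub_sigma_algebra.
by move/continuousP : shift_continuous; exact.
Qed.

Lemma continuous_shift (f : B -> R) : continuous f ->
  continuous (fun x : B => f (shift x)).
Proof.
by move=> cf x; apply: continuous_comp; [exact: shift_continuous|exact: cf].
Qed.

End shift_regularity.

Section equilibrium.
Context {R : realType} {M : compactMetricType R}.
Local Notation B := (seqspace M).
Variables (nu : probability (borel M) R) (G : B -> R).
Hypothesis cG : continuous G.
Local Notation P := (transfer nu G).
Implicit Types (mu : probability (borel B) R) (w : B -> R).

(** Invariance under the dual operator, uniqueness and shift invariance are all
    read off from this convergence. *)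
Definition attracting mu := forall w, continuous w -> forall e, 0 < e ->
  exists N, forall n, (N <= n)%N ->
    forall x, `|iter n P w x - \int[mu]_x w x| <= e.

(** The uniform limits define a positive normalized functional, to which the
    representation theorem applies. *)
Lemma attracting_exists (alpha : R) : 0 < alpha <= 1 -> holder alpha G ->
  (forall x, P (fun=> 1) x = 1) -> exists mu, attracting mu.
Proof.
move=> alpha01 hG G1.
pose L w : R := limn (fun n => iter n P w point).
have LP w : continuous w -> forall e, 0 < e -> exists N, forall n, (N <= n)%N ->
    forall x, `|iter n P w x - L w| <= e.
  move=> cw; have [l Hl] := transfer_iter_cvg alpha01 hG G1 cw.
  suff <- : l = L w by [].
  apply/esym/cvg_lim => //; apply/cvgrPdist_le => e e0.
  by have [N HN] := Hl e e0; exists N => // n /HN/(_ point); rewrite distrC.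
have Lcvg w : continuous w -> iter n P w point @[n --> \oo] --> L w.
  move=> cw; apply/cvgrPdist_le => e e0.
  by have [N HN] := LP w cw e e0; exists N => // n /HN/(_ point); rewrite distrC.
have LD (f g : B -> R) : continuous f -> continuous g ->
    L (fun x => f x + g x) = L f + L g.
  move=> cf cg; apply: cvg_lim => //.
  rewrite (_ : (fun n => _) = fun n => iter n P f point + iter n P g point).
    by apply: cvgD; exact: Lcvg.
  apply/funext => n.
  suff -> : iter n P (fun x => f x + g x) = fun x => iter n P f x + iter n P g x by [].
  elim: n => //= n ->; rewrite transferD//; exact: transfer_iter_continuous.
have LZ (c : R) (f : B -> R) : continuous f -> L (fun x => c * f x) = c * L f.
  move=> cf; apply: cvg_lim => //.
  rewrite (_ : (fun n => _) = fun n => c * iter n P f point).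
    by apply: cvgMr; exact: Lcvg.
  apply/funext => n.
  suff -> : iter n P (fun x => c * f x) = fun x => c * iter n P f x by [].
  elim: n => //= n ->; rewrite transferZ//; exact: transfer_iter_continuous.
have Lge0 (f : B -> R) : continuous f -> (forall x, 0 <= f x) -> 0 <= L f.
  move=> cf f0; apply: limr_ge; first by apply/cvg_ex; exists (L f); exact: Lcvg.
  apply: nearW => n; move: (point : B); elim: n => [|n IH] x //=.
  have c0 : continuous (fun _ : B => 0 : R) by exact: cst_continuous.
  have := @le_transfer _ _ nu G (fun=> 0) (iter n P f) cG c0.
  move=> /(_ (@transfer_iter_continuous _ _ nu _ _ n cG cf) IH x).
  by rewrite (transfer_cst alpha01 hG G1).
have L1 : L (fun=> 1) = 1.
  apply: cvg_lim => //; rewrite (_ : (fun n => _) = fun=> 1); first exact: cvg_cst.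
  by apply/funext => n; rewrite (transfer_iter_cst alpha01 hG G1).
have [mu muL] := riesz_representation (PositiveFunctional LD LZ Lge0 L1).
by exists mu => w cw; rewrite (muL w cw); exact: LP.
Qed.

Section attracting_theory.
Variable mu : probability (borel B) R.
Hypothesis muP : attracting mu.

Lemma attracting_transfer w : continuous w -> \int[mu]_x P w x = \int[mu]_x w x.
Proof.
move=> cw; apply/eqP; rewrite -subr_eq0 -normr_le0; apply/ler_addgt0Pl => e e0.
rewrite addr0.
have e2 : 0 < e / 2 by rewrite divr_gt0.
have [N HN] := muP cw e2.
have [N' HN'] := muP (@transfer_continuous _ _ nu _ _ cG cw) e2.
have := HN (maxn N N').+1 (leqW (leq_maxl _ _)) point.
have := HN' (maxn N N') (leq_maxr _ _) point.
rewrite -iterSr !ler_norml => /andP[? ?] /andP[? ?].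
by apply/andP; split; lra.
Qed.

Lemma attracting_dual : dual_transfer nu G mu mu.
Proof.
move=> w cw; rewrite !continuous_integral_fin ?attracting_transfer//.
exact: transfer_continuous.
Qed.

Lemma attracting_unique mu' : dual_transfer nu G mu' mu' ->
  forall E : set (borel B), measurable E -> mu' E = mu E.
Proof.
move=> dmu'; apply: eq_measure_lipschitz => f L fL.
have cf := lipschitz_continuous fL.
have inv n : \int[mu']_x f x = \int[mu']_x iter n P f x.
  elim: n => //= n ->; have cn := @transfer_iter_continuous _ _ nu _ _ n cG cf.
  have := dmu' _ cn; rewrite !continuous_integral_fin//; first by case.
  exact: transfer_continuous.
apply/eqP; rewrite -subr_eq0 -normr_le0; apply/ler_addgt0Pl => e e0.
rewrite addr0; have [N HN] := muP cf e0; rewrite (inv N).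
apply: Rintegral_near_cst; first exact: transfer_iter_continuous.
exact: HN.
Qed.

(** Since [shift (pcons a x)] is x, the operator maps [f \o shift] back to f, so
    the measure and its image under the shift integrate f alike. *)
Lemma attracting_shift_invariant : (forall x, P (fun=> 1) x = 1) ->
  shift_invariant mu.
Proof.
move=> G1 E mE.
pose sh : {mfun borel B >-> borel B} :=
  HB.pack (shift : borel B -> borel B)
    (isMeasurableFun.Build _ _ _ _ _ (@measurable_shift R M)).
rewrite -[LHS]/(distribution mu sh E).
apply: eq_measure_lipschitz => // f L fL.
have cf := lipschitz_continuous fL.
have cfs := continuous_shift cf.
have mf := continuous_borel_measurable cf.
transitivity (\int[mu]_x (f (shift x))).
  congr fine; apply: (@integral_distribution _ _ _ _ _ mu sh (EFin \o f)).
    exact/measurable_EFinP.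
  exact: (continuous_integrable mu cfs).
rewrite -(attracting_transfer cfs); apply: eq_Rintegral => x _.
rewrite -[RHS]mulr1 -(G1 x) /transfer -RintegralZl//; last first.
  by apply: (@transfer_integrable _ _ nu G (fun=> 1) x cG); exact: cst_continuous.
by apply: eq_Rintegral => a _; rewrite mulr1 mulrC.
Qed.

End attracting_theory.

End equilibrium.

(** * Normalization and the main theorem *)

Lemma uniform_cvgP (R : realType) (T : pseudoPMetricType R)
    (F : nat -> T -> R) (f : T -> R) :
  (forall e, 0 < e -> exists N, forall n, (N <= n)%N ->
     forall x, `|F n x - f x| <= e) ->
  {uniform, F @ \oo --> f}.
Proof.
move=> H U /uniform_nbhs[E [+ EU]]; rewrite -entourage_ballE => -[e /= e0 eE].
have e2 : 0 < e / 2 by rewrite divr_gt0.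
have [N HN] := H _ e2; exists N => // n /= Nn; apply: EU => x _; apply: eE.
rewrite /ball/= distrC (le_lt_trans (HN n Nn x))//.
by rewrite ltr_pdivrMr// ltr_pMr// ltr1n.
Qed.

Section normalization.
Context {R : realType} {M : compactMetricType R}.
Local Notation B := (seqspace M).
Variables (nu : probability (borel M) R) (alpha lam : R) (A psi : B -> R).
Hypotheses (alpha01 : 0 < alpha <= 1) (HA : holder alpha A).
Hypothesis psiP : main_eigen nu alpha A lam psi.
Local Notation Abar := (normalization A lam psi).

Let lam0 : 0 < lam. Proof. by case: psiP. Qed.
Let psi0 x : 0 < psi x. Proof. by case: psiP. Qed.
Let cA : continuous A.
Proof. by case/andP: alpha01 => a0 _; exact: continuous_holder HA. Qed.

Lemma main_eigen_continuous : continuous psi.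
Proof. by case/andP: alpha01 => a0 _; case: psiP => _ /(continuous_holder a0). Qed.
Local Notation cpsi := main_eigen_continuous.

Lemma main_eigen_continuousV : continuous (fun x => (psi x)^-1).
Proof.
move=> x; apply: (@cvgV _ _ _ (nbhs_filter (x : B))); first by rewrite gt_eqF.
exact: cpsi.
Qed.

Lemma main_eigen_bounded_below : exists2 c, 0 < c & forall x, c <= psi x.
Proof.
have [N N0 H] := continuous_bounded main_eigen_continuousV.
exists N^-1; first by rewrite invr_gt0.
move=> x; rewrite -[leRHS]invrK lef_pV2 ?posrE ?invr_gt0//.
by have := H x; rewrite ger0_norm// invr_ge0 ltW.
Qed.

Lemma normalization_holder : holder alpha Abar.
Proof.
case/andP: alpha01 => a0 _; have [c c0 cpsi] := main_eigen_bounded_below.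
case: psiP => _ hpsi _ _ _; have hl := holder_ln c0 cpsi hpsi.
apply: holderD; last exact: holder_cst.
apply: holderD; first exact: holderD.
by apply: holderN; exact: (holder_shift a0 hl).
Qed.

(** Along an inverse branch the coboundary term is
    ln (psi (pcons a x)) - ln (psi x), so the normalized operator is the original
    one conjugated by the multiplication by psi and divided by lam. *)
Lemma transfer_normalization w x : continuous w ->
  transfer nu Abar w x = transfer nu A (fun z => psi z * w z) x / (lam * psi x).
Proof.
move=> cw; rewrite /transfer -RintegralZr//; last first.
  exact: (@transfer_integrable _ _ nu A _ x cA (continuous_mul cpsi cw)).
apply: eq_Rintegral => a _.
rewrite /normalization !expRD !expRN !lnK ?posrE//.
rewrite -[shift (pcons a x)]/x; field.
by rewrite !gt_eqF.
Qed.

Lemma transfer_normalization1 x : transfer nu Abar (fun=> 1) x = 1.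
Proof.
rewrite transfer_normalization; last exact: cst_continuous.
rewrite (_ : (fun z => _) = psi); last by apply/funext => z; rewrite mulr1.
by case: psiP => _ _ _ _ ->; rewrite divff// mulf_neq0// gt_eqF.
Qed.

Lemma continuous_normalization : continuous Abar.
Proof.
by case/andP: alpha01 => a0 _; exact: (continuous_holder a0 normalization_holder).
Qed.

Lemma transfer_conjugation w : continuous w ->
  transfer nu A w = fun x => lam * psi x * transfer nu Abar (fun z => w z / psi z) x.
Proof.
move=> cw; apply/funext => x.
rewrite transfer_normalization; last exact: continuous_mul cw main_eigen_continuousV.
rewrite (_ : (fun z => _ * (_ / _)) = w); last first.
  by apply/funext => z; rewrite mulrC divfK// gt_eqF.
by rewrite mulrC divfK// mulf_neq0// gt_eqF.
Qed.

Lemma transfer_iter_conjugation w n x : continuous w ->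
  iter n (transfer nu A) w x / lam ^+ n =
  psi x * iter n (transfer nu Abar) (fun z => w z / psi z) x.
Proof.
move=> cw; have cwp := continuous_mul cw main_eigen_continuousV.
suff -> : iter n (transfer nu A) w = fun x =>
    lam ^+ n * (psi x * iter n (transfer nu Abar) (fun z => w z / psi z) x).
  by rewrite mulrC mulKf// expf_neq0// gt_eqF.
elim: n => [|n IH] /=.
  by apply/funext => z; rewrite expr0 mul1r mulrC divfK// gt_eqF.
have cn := @transfer_iter_continuous _ _ nu _ _ n continuous_normalization cwp.
rewrite IH transferZ//; last exact: continuous_mul cpsi cn.
rewrite transfer_conjugation; last exact: continuous_mul cpsi cn.
apply/funext => z; rewrite exprS.
rewrite (_ : (fun y => _ / _) = iter n (transfer nu Abar) (fun z => w z / psi z)).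
  by ring.
by apply/funext => y; rewrite mulrC mulKf// gt_eqF.
Qed.

End normalization.

Theorem theorem2 (R : realType) (M : compactMetricType R)
    (alpha : R) (alpha01 : 0 < alpha <= 1)
    (nu : probability (borel M) R) (nu_supp : msupport nu = [set: M])
    (A : seqspace M -> R) (HA : holder alpha A)
    (lam : R) (psi : seqspace M -> R)
    (psiP : main_eigen nu alpha A lam psi) :
  let Abar := normalization A lam psi in
  exists mu : probability (borel (seqspace M)) R,
    let rho : {measure set (borel (seqspace M)) -> \bar R} :=
      mdensity mu (main_eigen_inv_ge0 psiP)
        (main_eigen_inv_measurable alpha01 psiP) in
    [/\ dual_transfer nu Abar mu mu,
        forall mu' : probability (borel (seqspace M)) R,
          dual_transfer nu Abar mu' mu' ->
          forall E, measurable E -> mu' E = mu E,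
        shift_invariant mu,
        dual_transfer nu A rho (mscale (NngNum (main_eigen_lam_ge0 psiP)) rho) &
        forall w : seqspace M -> R, holder_continuous w ->
          {uniform, (fun n => iter n (transfer nu Abar) w) @ \oo -->
             (cst (\int[mu]_x w x) : seqspace M -> R)} /\
          {uniform, (fun n x => iter n (transfer nu A) w x / lam ^+ n) @ \oo -->
             (fun x => psi x * \int[rho]_x w x)}].
Proof.
move=> Abar.
have cA : continuous A by case/andP: alpha01 => a0 _; exact: continuous_holder HA.
have cpsiV := main_eigen_continuousV alpha01 psiP.
have hAbar : holder alpha Abar := normalization_holder alpha01 HA psiP.
have cAbar : continuous Abar := continuous_normalization alpha01 HA psiP.
have Abar1 x : transfer nu Abar (fun=> 1) x = 1.
  exact: (transfer_normalization1 alpha01 HA psiP).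
have [mu muP] := attracting_exists cAbar alpha01 hAbar Abar1.
exists mu => rho.
have rhoE (f : seqspace M -> R) : continuous f ->
    (\int[rho]_x (f x)%:E)%E = (\int[mu]_x (f x / psi x))%:E.
  move=> cf; rewrite -continuous_integral_fin; last exact: continuous_mul.
  rewrite integral_mdensity; first exact: eq_integral.
  by apply/measurable_EFinP; exact: continuous_borel_measurable.
have rhoI (f : seqspace M -> R) : continuous f ->
    rho.-integrable setT (EFin \o (f : borel (seqspace M) -> R)).
  move=> cf; apply/integrableP; split.
    by apply/measurable_EFinP; exact: continuous_borel_measurable.
  by have := rhoE _ (continuous_absr cf); rewrite /= => ->; rewrite ltry.
split.
- exact: (attracting_dual cAbar muP).
- exact: (attracting_unique cAbar muP).
- exact: (attracting_shift_invariant cAbar muP Abar1).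
- move=> phi cphi; have cphiV := continuous_mul cphi cpsiV.
  rewrite integral_mscale; last exact: rhoI.
  rewrite !rhoE//; last exact: transfer_continuous.
  rewrite -EFinM/=; congr EFin; rewrite -(attracting_transfer cAbar muP cphiV).
  rewrite -RintegralZl//; last first.
    by apply: continuous_integrable; exact: transfer_continuous.
  apply: eq_Rintegral => x _; rewrite (transfer_conjugation alpha01 HA psiP cphi).
  by have [_ _ /(_ x) px _ _] := psiP; field; rewrite gt_eqF.
move=> w [beta /andP[b0 _] hw]; have cw := continuous_holder b0 hw.
split.
  by apply: uniform_cvgP => e e0; exact: muP.
have -> : \int[rho]_x w x = \int[mu]_x (w x / psi x).
  by rewrite [LHS]/Rintegral rhoE.
apply: uniform_cvgP => e e0.
have [N HN] := muP _ (continuous_mul cw cpsiV) e e0.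
exists N => n Nn x; rewrite (transfer_iter_conjugation alpha01 HA psiP)//.
have [_ _ /(_ x) px [/(_ x) p1 _] _] := psiP.
rewrite -mulrBr normrM gtr0_norm// (le_trans _ (HN n Nn x))//.
by rewrite ler_piMl.
Qed.
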